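(* Let $\mathbb X=\mathbb T^d=\mathbb R^d/\mathbb Z^d$ with $d\ge2$, let $s>d/2$, and let $K$ be a continuous symmetric positive definite kernel on $\mathbb T^d$ with $H_K(\mathbb T^d)=H^s(\mathbb T^d)$ with equivalent norms. Then for every $\mu\in\mathcal P(\mathbb T^d)$ absolutely continuous with Lipschitz continuous density $\rho\in H^s(\mathbb T^d)$ there is a constant $c>0$, depending on $d$, $K$ and $\rho$, such that for all $L\ge1$ $$\min_{\nu\in\mathcal P^{\mathrm{Acurve}}_L(\mathbb T^d)}\mathscr D_K(\mu,\nu)\le c\,L^{-\frac{s}{d-1}}.$$
   Context: $\mathbb T^d$ carries the flat Riemannian metric (distance $\mathrm{dist}$) and normalized Lebesgue (Haar) measure $\sigma$. $H^s(\mathbb T^d)=\{f\in L^2:\sum_{k\in\mathbb Z^d}(1+4\pi^2|k|^2)^s|\hat f_k|^2<\infty\}$ with $\hat f_k=\int f(x)e^{-2\pi i\langle k,x\rangle}dx$. $H_K$: reproducing kernel Hilbert space of $K$; $\mathscr D_K(\mu,\nu)=\sup_{\|\varphi\|_{H_K}\le1}|\int\varphi\,d(\mu-\nu)|$. $\mathrm{Lip}(\mathbb T^d)$: Lipschitz $\gamma\colon[0,1]\to\mathbb T^d$ with $\gamma(0)=\gamma(1)$, $L(\gamma)$ its optimal Lipschitz constant; $\lambda$ Lebesgue measure on $[0,1]$; $\gamma_*$ pushforward. $\mathcal P^{\mathrm{Acurve}}_L(\mathbb T^d)=\{\gamma_*(\rho'\lambda):\gamma\in\mathrm{Lip}(\mathbb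 T^d),L(\gamma)\le L,\ \rho'\ge0,\int_0^1\rho'=1,\ \rho'\text{ Lipschitz with }L(\rho')\le L\}$. *)

(* Defs.v *)
From HB Require Import structures.
From mathcomp Require Import all_boot all_order all_algebra.
From mathcomp Require Import all_classical all_reals all_analysis.
Set Implicit Arguments. Unset Strict Implicit. Unset Printing Implicit Defensive.
Import Order.TTheory GRing.Theory Num.Theory.
Import numFieldNormedType.Exports.
Local Open Scope classical_set_scope.
Local Open Scope ring_scope.

Section Torus.
Variable R : realType.

(* Points of R^d; the torus T^d = R^d/Z^d is represented by R^d, functions on
   T^d by Z^d-periodic functions on R^d, and the fundamental domain is [0,1]^d. *)
Definition pt (d : nat) := d.-tuple R.

Definition shift d (x : pt d) (k : d.-tuple int) : pt d :=
  [tuple tnth x i + (tnth k i)%:~R | i < d].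

Definition tperiodic d (f : pt d -> R) : Prop :=
  forall x k, f (shift x k) = f x.

Definition tdist d (x y : pt d) : R :=
  inf [set Num.sqrt (\sum_(i < d) (tnth x i - tnth y i - (tnth k i)%:~R) ^+ 2)
      | k in [set: d.-tuple int]].

Definition unit_itv := [set t : R | 0 <= t <= 1].

(* Integral over [0,1]^d w.r.t. Lebesgue measure, as iterated integral
   (Tonelli/Fubini); this is the integral against the Haar measure sigma. *)
Fixpoint tint (n : nat) : (n.-tuple R -> \bar R) -> \bar R :=
  match n with
  | 0 => fun f => f [tuple]
  | n'.+1 => fun f =>
      (\int[lebesgue_measure]_(t in unit_itv)
         tint (fun y : n'.-tuple R => f (cons_tuple t y)))%E
  end.

Definition kdot d (k : d.-tuple int) (x : pt d) : R :=
  \sum_(i < d) (tnth k i)%:~R * tnth x i.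

(* real and imaginary parts (up to sign) of the Fourier coefficient \hat f_k *)
Definition fourier_re d (f : pt d -> R) (k : d.-tuple int) : \bar R :=
  tint (fun x => (f x * cos (2 * pi * kdot k x))%:E).
Definition fourier_im d (f : pt d -> R) (k : d.-tuple int) : \bar R :=
  tint (fun x => (f x * sin (2 * pi * kdot k x))%:E).

Definition sob_weight d (s : R) (k : d.-tuple int) : R :=
  (1 + 4 * pi ^+ 2 * \sum_(i < d) ((tnth k i)%:~R) ^+ 2) `^ s.

Definition sob_sum d (s : R) (f : pt d -> R) : \bar R :=
  (\esum_(k in [set: d.-tuple int])
     (sob_weight s k * (fine (fourier_re f k) ^+ 2 + fine (fourier_im f k) ^+ 2))%:E)%E.

(* Borel measurability on R^d (product sigma-algebra on d.-tuple R) *)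
Definition tmeasurable d (f : pt d -> R) : Prop :=
  measurable_fun [set: d.-tuple R] (f : d.-tuple R -> R).

Definition inHs d (s : R) (f : pt d -> R) : Prop :=
  [/\ tperiodic f, tmeasurable f,
      (tint (fun x => (f x ^+ 2)%:E) < +oo)%E & (sob_sum s f < +oo)%E].

Definition Hs_norm d (s : R) (f : pt d -> R) : R := Num.sqrt (fine (sob_sum s f)).

Definition ae_eq d (f g : pt d -> R) : Prop :=
  tint (fun x => `|f x - g x|%:E) = 0%E.

Definition kernel_periodic d (K : pt d -> pt d -> R) : Prop :=
  forall x y k, K (shift x k) y = K x y /\ K x (shift y k) = K x y.
Definition kernel_continuous d (K : pt d -> pt d -> R) : Prop :=
  forall x y (e : R), 0 < e -> exists2 del : R, 0 < del &
    forall x' y', tdist x x' < del -> tdist y y' < del -> `|K x' y' - K x y| < e.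
Definition kernel_symmetric d (K : pt d -> pt d -> R) : Prop :=
  forall x y, K x y = K y x.
Definition kernel_posdef d (K : pt d -> pt d -> R) : Prop :=
  forall (n : nat) (x : 'I_n -> pt d) (c : 'I_n -> R),
    0 <= \sum_(i < n) \sum_(j < n) c i * c j * K (x i) (x j).

(* (H, ip) is the reproducing kernel Hilbert space of K (a Hilbert space of
   functions on T^d with K(x,.) in H and <f, K(x,.)> = f(x)); by
   Moore--Aronszajn it is unique. *)
Definition ipnorm d (ip : (pt d -> R) -> (pt d -> R) -> R) (f : pt d -> R) : R :=
  Num.sqrt (ip f f).

Record is_RKHS d (K : pt d -> pt d -> R) (H : set (pt d -> R))
    (ip : (pt d -> R) -> (pt d -> R) -> R) : Prop := {
  rk_per : forall f, H f -> tperiodic f;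
  rk_zero : H (fun _ => 0);
  rk_lin : forall a f g, H f -> H g -> H (fun x => a * f x + g x);
  rk_sym : forall f g, H f -> H g -> ip f g = ip g f;
  rk_ip_lin : forall a f g h, H f -> H g -> H h ->
     ip (fun x => a * f x + g x) h = a * ip f h + ip g h;
  rk_pos : forall f, H f -> 0 <= ip f f;
  rk_def : forall f, H f -> ip f f = 0 -> f = (fun _ => 0);
  rk_complete : forall u : nat -> pt d -> R, (forall n, H (u n)) ->
     (forall e : R, 0 < e -> exists N, forall m n, (N <= m)%N -> (N <= n)%N ->
        ipnorm ip (fun x => u m x - u n x) < e) ->
     exists2 f, H f & (forall e : R, 0 < e -> exists N, forall n, (N <= n)%N ->
        ipnorm ip (fun x => u n x - f x) < e);
  rk_kernel : forall x, H (K x);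
  rk_reproducing : forall f x, H f -> ip f (K x) = f x }.

Definition HK_eq_Hs d (s : R) (H : set (pt d -> R))
    (ip : (pt d -> R) -> (pt d -> R) -> R) : Prop :=
  [/\ forall f, H f -> inHs s f,
      forall f, inHs s f -> exists2 g, H g & ae_eq f g &
      exists a b : R, [/\ 0 < a, 0 < b &
        forall f, H f -> a * Hs_norm s f <= ipnorm ip f /\ ipnorm ip f <= b * Hs_norm s f]].

Definition torus_lipschitz d (f : pt d -> R) : Prop :=
  exists C : R, forall x y, `|f x - f y| <= C * tdist x y.

(* Data (gamma, rho') defining nu = gamma_*(rho' lambda) in P^Acurve_L(T^d):
   gamma : [0,1] -> T^d closed, L-Lipschitz (i.e. L(gamma) <= L);
   rho' >= 0, L-Lipschitz on [0,1], of integral 1. *)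
Definition acurve_data d (L : R) (gamma : R -> pt d) (rho' : R -> R) : Prop :=
  [/\ tdist (gamma 0) (gamma 1) = 0,
      forall t t', unit_itv t -> unit_itv t' ->
        tdist (gamma t) (gamma t') <= L * `|t - t'|,
      forall t, unit_itv t -> 0 <= rho' t,
      forall t t', unit_itv t -> unit_itv t' -> `|rho' t - rho' t'| <= L * `|t - t'|
    & (\int[lebesgue_measure]_(t in unit_itv) (rho' t)%:E = 1)%E].

(* D_K(mu, nu) for mu = rho sigma and nu = gamma_*(rho' lambda):
   sup over ||phi||_{H_K} <= 1 of |int phi dmu - int phi dnu|, where
   int phi dmu = int_{T^d} phi rho dsigma and
   int phi dnu = int_0^1 phi(gamma t) rho'(t) dt. *)
Definition discrepancy d (H : set (pt d -> R)) (ip : (pt d -> R) -> (pt d -> R) -> R)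
    (rho : pt d -> R) (gamma : R -> pt d) (rho' : R -> R) : \bar R :=
  ereal_sup [set `| tint (fun x => (phi x * rho x)%:E)
                    - \int[lebesgue_measure]_(t in unit_itv) (phi (gamma t) * rho' t)%:E |%E
            | phi in [set phi | H phi /\ ip phi phi <= 1]].

End Torus.

(* Main.v *)
(* The curve is the closed geodesic t -> t (1, N, ..., N^(d-1)), of length of
   order N^(d-1), with weight proportional to the density rho along it. Writing
   functions in the real orthonormal basis cas_k(x) = cos(2 pi k.x) + sin(2 pi k.x),
   the line integral of cas_k cas_j differs from its torus integral only if k - j
   is a nonzero point of the lattice {l : l_0 + l_1 N + ... + l_(d-1) N^(d-1) = 0},
   whose nonzero points have length at least of order N. Peetre's inequality and
   2xy <= x^2/nu + nu y^2 with nu = N^(-s) then bound the quadrature error of the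
   product of two functions of H^s by a constant times N^(-s).
   Uniqueness of Fourier expansions in H_K is free: the norm equivalence turns
   convergence of the coefficients into convergence of the partial sums in H_K,
   hence uniform convergence. *)
Require Import Defs.
From HB Require Import structures.
From mathcomp Require Import all_boot all_order all_algebra.
From mathcomp Require Import all_classical all_reals all_analysis.
From mathcomp Require Import measurable_realfun.
From mathcomp Require Import ring lra.
Set Implicit Arguments. Unset Strict Implicit. Unset Printing Implicit Defensive.
Import Order.TTheory GRing.Theory Num.Theory.
Import numFieldNormedType.Exports.
Local Open Scope classical_set_scope.
Local Open Scope ring_scope.

(** * Integrals of bounded measurable functions *)

(** With L of order N^(d-1), an error N^(-s) is L^(-s/(d-1)). The weight must have mass one, so it
    is rho divided by its integral Z along the curve, and the error for a test function phi then
    involves two quadrature errors: that of phi * rho and that of rho * 1. This is why products of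
    two functions of H_K are estimated, and why 1 has to be placed in H_K. The product is treated
    bilinearly, each pair of frequencies on its own, with the Sobolev weights of the two factors
    kept apart. Two obstacles shape the rest. Z is bounded below only for large N; smaller N occur
    only for L in a bounded range, where a point mass and a large constant suffice. And the
    hypothesis on H_K matches a function of H^s with one of H_K only almost everywhere; continuity
    of both restores equality, which is how the density, the constant 1 and the trigonometric
    partial sums get into H_K. *)

Section BoundedMeasurable.
Context (R : realType) (d : measure_display) (T : measurableType d).
Implicit Types f g : T -> R.

(** A class closed under sums, products and measurable substitutions, so that integrability over
    [0, 1] comes once and for all from [bmeas_integrable]. Global boundedness is affordable because
    the functions on the torus are periodic. *)
Definition bmeas f := measurable_fun [set: T] f /\ exists M : R, forall x, `|f x| <= M.

Lemma bmeasD f g : bmeas f -> bmeas g -> bmeas (fun x => f x + g x).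
Proof.
move=> [mf [M fM]] [mg [N gN]]; split; first exact: measurable_funD.
by exists (M + N) => x; rewrite (le_trans (ler_normD _ _))// lerD.
Qed.

Lemma bmeasM f g : bmeas f -> bmeas g -> bmeas (fun x => f x * g x).
Proof.
move=> [mf [M fM]] [mg [N gN]]; split; first exact: measurable_funM.
by exists (M * N) => x; rewrite normrM ler_pM.
Qed.

Lemma bmeas_cst (c : R) : bmeas (fun=> c).
Proof. by split; [exact: measurable_cst|exists `|c|]. Qed.

Lemma bmeasZ c f : bmeas f -> bmeas (fun x => c * f x).
Proof. by move=> bf; apply: bmeasM => //; exact: bmeas_cst. Qed.

Lemma bmeasB f g : bmeas f -> bmeas g -> bmeas (fun x => f x - g x).
Proof.
move=> [mf [M fM]] [mg [N gN]]; split; first exact: measurable_funB.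
by exists (M + N) => x; rewrite (le_trans (ler_normB _ _))// lerD.
Qed.

Lemma bmeas_norm f : bmeas f -> bmeas (fun x => `|f x|).
Proof.
move=> [mf [M fM]]; split; last by exists M => x; rewrite normr_id.
exact: (measurableT_comp (@normr_measurable R setT)).
Qed.

Lemma bmeas_indic (A : set T) : measurable A -> bmeas (\1_A).
Proof.
move=> mA; split; first exact: measurable_indic.
by exists 1 => x; rewrite indicE; case: (_ \in _); rewrite ?normr1 ?normr0.
Qed.

Lemma bmeas_sum (I : Type) (r : seq I) (f : I -> T -> R) :
  (forall i, bmeas (f i)) -> bmeas (fun x => \sum_(i <- r) f i x).
Proof.
move=> bf; elim: r => [|i r IH].
  by under eq_fun do rewrite big_nil; exact: bmeas_cst.
by under eq_fun do rewrite big_cons; exact: bmeasD.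
Qed.

End BoundedMeasurable.

Lemma bmeas_comp (R : realType) d d' (T : measurableType d) (T' : measurableType d')
    (h : T' -> T) (f : T -> R) :
  measurable_fun [set: T'] h -> bmeas f -> bmeas (fun x => f (h x)).
Proof.
by move=> mh [mf [M fM]]; split; [exact: measurableT_comp|exists M].
Qed.

Section UnitIntegral.
Variable R : realType.
Notation mu := (@lebesgue_measure R).
Notation U := (@unit_itv R).

Lemma unit_itvE : U = `[0, 1]%classic.
Proof. by rewrite set_itvE. Qed.

Lemma measurable_unit_itv : measurable U.
Proof. by rewrite unit_itvE; exact: measurable_itv. Qed.

Lemma mu_unit_itv : mu U = 1%E.
Proof. by rewrite unit_itvE lebesgue_measure_itv/= lte01 oppr0 adde0. Qed.

Local Hint Resolve measurable_unit_itv : core.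

Lemma bmeas_integrable f : bmeas f -> mu.-integrable U (EFin \o f).
Proof.
move=> [mf [M fM]]; apply: measurable_bounded_integrable => //.
- by rewrite [X in (X < _)%E]mu_unit_itv ltry.
- exact: measurable_funTS.
- by exists M; split; [exact: num_real|move=> r Mr x _; exact: le_trans (fM x) (ltW Mr)].
Qed.

Definition uint (f : R -> R) : R := (\int[mu]_(t in U) f t)%R.

Lemma uint_cst c : uint (fun=> c) = c.
Proof. by rewrite /uint Rintegral_cst// [X in fine X]mu_unit_itv mulr1. Qed.

Lemma uint_EFin f : bmeas f -> (\int[mu]_(t in U) (f t)%:E)%E = (uint f)%:E.
Proof.
move=> bf; rewrite /uint /Rintegral fineK//.
exact: (integrable_fin_num _ (bmeas_integrable bf)).
Qed.

Lemma uintD f g : bmeas f -> bmeas g -> uint (fun t => f t + g t) = uint f + uint g.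
Proof. by move=> bf bg; rewrite /uint RintegralD//; exact: bmeas_integrable. Qed.

Lemma uintB f g : bmeas f -> bmeas g -> uint (fun t => f t - g t) = uint f - uint g.
Proof. by move=> bf bg; rewrite /uint RintegralB//; exact: bmeas_integrable. Qed.

Lemma uintZ c f : bmeas f -> uint (fun t => c * f t) = c * uint f.
Proof. by move=> bf; rewrite /uint RintegralZl//; exact: bmeas_integrable. Qed.

Lemma eq_uint f g : (forall t, U t -> f t = g t) -> uint f = uint g.
Proof. by move=> fg; apply: eq_Rintegral => t; rewrite inE; exact: fg. Qed.

Lemma le_uint f g : bmeas f -> bmeas g -> (forall t, U t -> f t <= g t) ->
  uint f <= uint g.
Proof. by move=> bf bg; rewrite /uint => fg; apply: le_Rintegral => //; exact: bmeas_integrable. Qed.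

Lemma uint_norm_le f M : bmeas f -> (forall t, U t -> `|f t| <= M) -> `|uint f| <= M.
Proof.
move=> bf fM; rewrite ler_norml -{1}(uint_cst (- M)) -{2}(uint_cst M).
by apply/andP; split; apply: le_uint => //; (try exact: bmeas_cst);
  move=> t /fM; rewrite ler_norml => /andP[].
Qed.

Lemma uint_sum (I : Type) (r : seq I) (f : I -> R -> R) :
  (forall i, bmeas (f i)) ->
  uint (fun x => \sum_(i <- r) f i x) = \sum_(i <- r) uint (f i).
Proof.
move=> bf; elim: r => [|i r IH].
  by rewrite big_nil; under [LHS]eq_uint do rewrite big_nil; rewrite uint_cst.
under [LHS]eq_uint do rewrite big_cons.
by rewrite uintD// ?IH ?big_cons//; exact: bmeas_sum.
Qed.

(** As [eta <= 1 / 2], one of [x, x + eta] and [x - eta, x] stays inside [0, 1], so even an endpoint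
    has a one-sided interval of full length [eta]. *)
Lemma uint_ge_itv f c x eta : bmeas f -> U x -> 0 <= c -> 0 < eta -> eta <= 1 / 2 ->
  (forall t, U t -> 0 <= f t) -> (forall t, U t -> `|t - x| <= eta -> c <= f t) ->
  c * eta <= uint f.
Proof.
move=> bf Ux c0 e0 e2 f0 fc.
have [u [u0 u1 ux xu]] : exists u, [/\ 0 <= u, u + eta <= 1, u <= x & x <= u + eta].
  move: Ux => /andP[x0 x1].
  by have [x2|x2] := leP x (1 / 2); [exists x|exists (x - eta)]; split; lra.
have mI : measurable (`[u, u + eta]%classic : set R) by exact: measurable_itv.
have muI : mu `[u, u + eta]%classic = eta%:E.
  by rewrite lebesgue_measure_itv/= lte_fin ltrDl e0 -EFinB addrAC subrr add0r.
have bI : bmeas (fun t => c * \1_(`[u, u + eta]%classic : set R) t).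
  by apply: bmeasZ; exact: bmeas_indic.
apply: le_trans (le_uint bI bf _); last first.
  move=> t Ut; rewrite indicE; case: (boolP (t \in _)); last by rewrite mulr0 f0.
  rewrite inE/= in_itv/=.
  move=> /andP[tu ut]; rewrite mulr1 fc//.
  by rewrite ler_norml; apply/andP; split; lra.
rewrite uintZ; last exact: bmeas_indic.
rewrite /uint /Rintegral integral_indic// (_ : _ `&` _ = `[u, u + eta]%classic); last first.
  apply/seteqP; split => [t []//|t /= tI]; split => //.
  by move: tI; rewrite in_itv/= /unit_itv/= => /andP[? ?]; apply/andP; split; lra.
by rewrite [X in fine X]muI.
Qed.

Lemma uint_param d (T : measurableType d) (h : T * R -> R) : bmeas h ->
  bmeas (fun x => uint (fun t => h (x, t))).
Proof.
move=> bh; have [mh [M hM]] := bh.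
have bhx x : bmeas (fun t => h (x, t)).
  split; last by exists M.
  apply: (measurableT_comp mh); exact: measurable_pair1.
split; last by exists M => x; apply: uint_norm_le.
(* Tonelli's measurability statement concerns nonnegative functions on the whole line: add the bound
   [M], cut off by the indicator of [0, 1], and subtract [M], its own integral over [0, 1], at the
   end. *)
pose h' p : \bar R := ((h p + M) * \1_U p.2)%:E.
have h'0 p : (0 <= h' p)%E.
  rewrite /h' lee_fin mulr_ge0//.
  by have := hM p; rewrite ler_norml => /andP[? ?]; lra.
have mh' : measurable_fun setT h'.
  apply/measurable_EFinP; apply: measurable_funM; first exact: measurable_funD.
  by apply: (measurableT_comp (measurable_indic _)).
have := @measurable_fun_fubini_tonelli_F _ _ _ _ _ mu h' mh' h'0.
move=> mF; rewrite (_ : (fun x => _) = (fun x => fine (fubini_F mu h' x) - M)).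
  by apply: measurable_funB => //; apply: measurableT_comp mF; exact: fine_measurable.
apply/funext => x; rewrite /fubini_F/h'.
rewrite (_ : (\int[_]_y _)%E = \int[mu]_(t in U) (h (x, t) + M)%:E)%E.
  have bM : bmeas (fun _ : R => M) by exact: bmeas_cst.
  by rewrite uint_EFin; [rewrite uintD// uint_cst/= addrK|exact: (bmeasD (bhx x) bM)].
rewrite [RHS]integral_mkcond; apply: eq_integral => t _ /=.
by rewrite patchE indicE; case: (t \in U); rewrite ?mulr1 ?mulr0.
Qed.

End UnitIntegral.

Section CubeIntegral.
Variable R : realType.
Implicit Types n : nat.

Fixpoint rint n : (n.-tuple R -> R) -> R :=
  match n with
  | 0 => fun f => f [tuple]
  | n'.+1 => fun f => uint (fun t => rint (fun y : n'.-tuple R => f (cons_tuple t y)))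
  end.

Definition cube n := [set x : n.-tuple R | forall i, unit_itv (tnth x i)].

Lemma cube_cons n (t : R) (y : n.-tuple R) :
  unit_itv t -> cube y -> cube (cons_tuple t y).
Proof.
move=> ut cy i; have [->|] := eqVneq i ord0; first by rewrite tnth0.
by case: (unliftP ord0 i) => [j ->|->]; rewrite ?eqxx// tnthS.
Qed.

(** The parameter space is arbitrary so that the induction can absorb the first coordinate of the
    cube into it. *)
Lemma bmeas_rint n d (T : measurableType d) (f : T * n.-tuple R -> R) :
  bmeas f -> bmeas (fun x => rint (fun y => f (x, y))).
Proof.
elim: n d T f => [|n IH] d T f bf /=.
  apply: (bmeas_comp _ bf); exact: measurable_pair2.
pose g (p : (T * R) * n.-tuple R) : R := f (p.1.1, cons_tuple p.1.2 p.2).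
have bg : bmeas g.
  apply: (bmeas_comp _ bf); apply: measurable_fun_pair.
    exact: measurableT_comp.
  apply: measurable_cons => //; exact: measurableT_comp.
exact: uint_param (IH _ _ _ bg).
Qed.

Lemma bmeas_section n (f : n.+1.-tuple R -> R) t :
  bmeas f -> bmeas (fun y => f (cons_tuple t y)).
Proof. by move=> bf; apply: (bmeas_comp _ bf); apply: measurable_cons. Qed.

Lemma bmeas_rint_section n (f : n.+1.-tuple R -> R) :
  bmeas f -> bmeas (fun t => rint (fun y => f (cons_tuple t y))).
Proof.
move=> bf; apply: (@bmeas_rint _ _ _ (fun p => f (cons_tuple p.1 p.2))).
by apply: (bmeas_comp _ bf); apply: measurable_cons.
Qed.

Lemma tint_EFin n (f : n.-tuple R -> R) : bmeas f ->
  tint (fun x => (f x)%:E) = (rint f)%:E.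
Proof.
elim: n f => [//|n IH] f bf /=.
rewrite -uint_EFin; last exact: bmeas_rint_section.
by apply: eq_integral => t _; rewrite IH//; exact: bmeas_section.
Qed.

Lemma rint_cst n (c : R) : rint (fun _ : n.-tuple R => c) = c.
Proof. by elim: n => [//|n IH] /=; rewrite IH uint_cst. Qed.

Lemma rintD n (f g : n.-tuple R -> R) : bmeas f -> bmeas g ->
  rint (fun x => f x + g x) = rint f + rint g.
Proof.
elim: n f g => [//|n IH] f g bf bg /=.
rewrite -uintD; [|exact: bmeas_rint_section|exact: bmeas_rint_section].
by apply: eq_uint => t _; rewrite IH//; exact: bmeas_section.
Qed.

Lemma rintB n (f g : n.-tuple R -> R) : bmeas f -> bmeas g ->
  rint (fun x => f x - g x) = rint f - rint g.
Proof.
elim: n f g => [//|n IH] f g bf bg /=.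
rewrite -uintB; [|exact: bmeas_rint_section|exact: bmeas_rint_section].
by apply: eq_uint => t _; rewrite IH//; exact: bmeas_section.
Qed.

Lemma rintZ n c (f : n.-tuple R -> R) : bmeas f ->
  rint (fun x => c * f x) = c * rint f.
Proof.
elim: n f => [//|n IH] f bf /=.
rewrite -uintZ; last exact: bmeas_rint_section.
by apply: eq_uint => t _; rewrite IH//; exact: bmeas_section.
Qed.

Lemma rint_sum n (I : Type) (r : seq I) (f : I -> n.-tuple R -> R) :
  (forall i, bmeas (f i)) ->
  rint (fun x => \sum_(i <- r) f i x) = \sum_(i <- r) rint (f i).
Proof.
move=> bf; elim: r => [|i r IH].
  rewrite big_nil (_ : (fun x => _) = fun=> 0) ?rint_cst//.
  by apply/funext => x; rewrite big_nil.
rewrite (_ : (fun x => _) = fun x => f i x + \sum_(j <- r) f j x).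
  by rewrite rintD// ?IH ?big_cons//; exact: bmeas_sum.
by apply/funext => x; rewrite big_cons.
Qed.

Lemma le_rint n (f g : n.-tuple R -> R) : bmeas f -> bmeas g ->
  (forall x, cube x -> f x <= g x) -> rint f <= rint g.
Proof.
elim: n f g => [|n IH] f g bf bg fg /=; first by apply: fg; case.
apply: le_uint; [exact: bmeas_rint_section|exact: bmeas_rint_section|].
move=> t ut; apply: IH; [exact: bmeas_section|exact: bmeas_section|].
by move=> x cx; apply: fg; exact: cube_cons.
Qed.

Lemma rint_norm_le n (f : n.-tuple R -> R) M : bmeas f ->
  (forall x, cube x -> `|f x| <= M) -> `|rint f| <= M.
Proof.
move=> bf fM; rewrite ler_norml -{1}(@rint_cst n (- M)) -{2}(@rint_cst n M).
by apply/andP; split; apply: le_rint => //; (try exact: bmeas_cst);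
  move=> t /fM; rewrite ler_norml => /andP[].
Qed.

Lemma rint_ge_box n (f : n.-tuple R -> R) c x eta : bmeas f -> cube x ->
  0 <= c -> 0 < eta -> eta <= 1 / 2 -> (forall y, cube y -> 0 <= f y) ->
  (forall y, cube y -> (forall i, `|tnth y i - tnth x i| <= eta) -> c <= f y) ->
  c * eta ^+ n <= rint f.
Proof.
elim: n f x => [|n IH] f x bf cx c0 e0 e2 f0 fc /=.
  by rewrite mulr1; apply: fc; case.
case/tupleP: x cx fc => a x cx fc.
have ua : unit_itv a by have := cx ord0; rewrite tnth0.
have cx' : cube x by move=> i; have := cx (lift ord0 i); rewrite tnthS.
rewrite exprSr mulrA; apply: (@uint_ge_itv _ _ _ a) => //.
- exact: bmeas_rint_section.
- by rewrite mulr_ge0// exprn_ge0// ltW.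
- move=> t ut; rewrite -(@rint_cst n 0); apply: le_rint.
  + exact: bmeas_cst.
  + exact: bmeas_section.
  + by move=> y cy; apply/f0/cube_cons.
- move=> t ut ta; apply: (IH _ x) => //.
  + exact: bmeas_section.
  + by move=> y cy; apply/f0/cube_cons.
  + move=> y cy yx; apply: fc; first exact: cube_cons.
    move=> i; case: (unliftP ord0 i) => [j ->|->]; rewrite ?tnth0//.
    by rewrite !tnthS.
Qed.

End CubeIntegral.

(** * Orthogonality of the functions cas *)

Section Trigonometric.
Variable R : realType.

Lemma continuous_cosM (c : R) : continuous (fun t : R => cos (c * t)).
Proof.
move=> t; apply: (@continuous_comp _ _ _ (fun t => c * t) cos).
  by apply: continuousM; [exact: cst_continuous|].
exact: continuous_cos.
Qed.

Lemma continuous_sinM (c : R) : continuous (fun t : R => sin (c * t)).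
Proof.
move=> t; apply: (@continuous_comp _ _ _ (fun t => c * t) sin).
  by apply: continuousM; [exact: cst_continuous|].
exact: continuous_sin.
Qed.

Lemma bmeas_cos d (T : measurableType d) (f : T -> R) :
  measurable_fun [set: T] f -> bmeas (fun x => cos (f x)).
Proof.
move=> mf; split; last by exists 1 => x; exact: cos_max.
apply: (measurableT_comp _ mf); apply: continuous_measurable_fun; exact: continuous_cos.
Qed.

Lemma bmeas_sin d (T : measurableType d) (f : T -> R) :
  measurable_fun [set: T] f -> bmeas (fun x => sin (f x)).
Proof.
move=> mf; split; last by exists 1 => x; exact: sin_max.
apply: (measurableT_comp _ mf); apply: continuous_measurable_fun; exact: continuous_sin.
Qed.

Lemma uint_FTC2 (f F : R -> R) : bmeas f -> continuous f ->
  (forall t : R, is_derive t 1 F (f t)) -> uint f = F 1 - F 0.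
Proof.
move=> bf cf dF; apply: EFin_inj; rewrite -uint_EFin// unit_itvE EFinB.
have cF : continuous F.
  by move=> t; apply: differentiable_continuous; apply/derivable1_diffP; case: (dF t).
apply: continuous_FTC2 => //.
- exact: continuous_subspaceT.
- split; first by move=> t _; case: (dF t).
  + exact/cvg_at_right_filter/cF.
  + exact/cvg_at_left_filter/cF.
- by move=> t _; rewrite derive1E; case: (dF t).
Qed.

Lemma cos_int (m : int) : cos (2 * pi * m%:~R) = 1 :> R.
Proof.
have cosn n : cos (2 * pi * n%:R) = 1 :> R.
  elim: n => [|n IH]; first by rewrite mulr0 cos0.
  rewrite (_ : 2 * pi * n.+1%:R = 2 * pi * n%:R + pi *+ 2) ?cosD2pi//.
  by rewrite -natr1; ring.
by case: m => p; rewrite ?NegzE ?mulrNz ?mulrN ?cosN cosn.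
Qed.

Lemma sin_int (m : int) : sin (2 * pi * m%:~R) = 0 :> R.
Proof. by apply: cos1sin0; rewrite cos_int normr1. Qed.

Lemma uint_cosM (m : int) : uint (fun t : R => cos (2 * pi * (m%:~R * t))) = (m == 0)%:R.
Proof.
have [->|m0] := eqVneq m 0.
  by rewrite -[RHS](@uint_cst R 1); apply: eq_uint => t _; rewrite mul0r mulr0 cos0.
set c : R := 2 * pi * m%:~R.
have c0 : c != 0 by rewrite !mulf_neq0// ?intr_eq0// ?gt_eqF// pi_gt0.
rewrite (@eq_uint _ _ (fun t => cos (c * t))); last by move=> t _; rewrite mulrA.
have dF (t : R) : is_derive t 1 (fun t => c^-1 * sin (c * t)) (cos (c * t)).
  apply: is_derive_eq; rewrite /GRing.scale/= mulr1; field.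
  by [].
rewrite (uint_FTC2 _ _ dF).
- by rewrite mulr1 mulr0 sin0 sin_int mulr0 subrr.
- by apply: bmeas_cos; exact: measurable_funM.
- exact: continuous_cosM.
Qed.

Lemma uint_sinM (m : int) : uint (fun t : R => sin (2 * pi * (m%:~R * t))) = 0.
Proof.
have [->|m0] := eqVneq m 0.
  by rewrite -[RHS](@uint_cst R 0); apply: eq_uint => t _; rewrite mul0r mulr0 sin0.
set c : R := 2 * pi * m%:~R.
have c0 : c != 0 by rewrite !mulf_neq0// ?intr_eq0// ?gt_eqF// pi_gt0.
rewrite (@eq_uint _ _ (fun t => sin (c * t))); last by move=> t _; rewrite mulrA.
have dF (t : R) : is_derive t 1 (fun t => - c^-1 * cos (c * t)) (sin (c * t)).
  apply: is_derive_eq; rewrite /GRing.scale/= mulr1; field.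
  by [].
rewrite (uint_FTC2 _ _ dF).
- by rewrite mulr1 mulr0 cos0 cos_int subrr.
- by apply: bmeas_sin; exact: measurable_funM.
- exact: continuous_sinM.
Qed.

End Trigonometric.

Section Characters.
Context (R : realType) (d : nat).
Implicit Types (k j : d.-tuple int) (x y : d.-tuple R).

Definition tsub k j : d.-tuple int := [tuple tnth k i - tnth j i | i < d].
Definition tadd k j : d.-tuple int := [tuple tnth k i + tnth j i | i < d].
Definition topp k : d.-tuple int := [tuple - tnth k i | i < d].
Definition tzero : d.-tuple int := [tuple 0 | i < d].

Definition arg k x : R := 2 * pi * kdot k x.
(* The functions [cas k] form a real orthonormal basis indexed by Z^d. *)
Definition cas k x : R := cos (arg k x) + sin (arg k x).

Lemma toppK : involutive topp.
Proof. by move=> k; apply: eq_from_tnth => i; rewrite !tnth_mktuple opprK. Qed.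

Lemma arg_tsub k j x : arg (tsub k j) x = arg k x - arg j x.
Proof.
rewrite /arg /kdot -mulrBr -sumrB; congr (_ * _).
by apply: eq_bigr => i _; rewrite tnth_mktuple intrB mulrBl.
Qed.

Lemma arg_tadd k j x : arg (tadd k j) x = arg k x + arg j x.
Proof.
rewrite /arg /kdot -mulrDr -big_split; congr (_ * _).
by apply: eq_bigr => i _; rewrite tnth_mktuple intrD mulrDl.
Qed.

Lemma arg_topp k x : arg (topp k) x = - arg k x.
Proof.
rewrite /arg /kdot -mulrN -sumrN; congr (_ * _).
by apply: eq_bigr => i _; rewrite tnth_mktuple intrN mulNr.
Qed.

Lemma tsub_eq0 k j : (tsub k j == tzero) = (k == j).
Proof.
apply/eqP/eqP => [e|->]; apply: eq_from_tnth => i; last by rewrite !tnth_mktuple subrr.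
by apply/eqP; rewrite -subr_eq0; have := congr1 (@tnth _ _ ^~ i) e; rewrite !tnth_mktuple => ->.
Qed.

(** The sum frequency enters only through a sine, whose integral over the torus and over the
    geodesic is zero whatever the frequency. Hence only the difference [tsub k j] matters, both for
    orthonormality and for aliasing. *)
Lemma casM k j x :
  cas k x * cas j x = cos (arg (tsub k j) x) + sin (arg (tadd k j) x).
Proof. by rewrite /cas arg_tsub arg_tadd cosB sinD; ring. Qed.

Lemma cas0 x : cas tzero x = 1.
Proof.
rewrite /cas /arg /kdot big1 ?mulr0 ?cos0 ?sin0 ?addr0// => i _.
by rewrite tnth_mktuple mul0r.
Qed.

Lemma cas_topp k x : cas (topp k) x = cos (arg k x) - sin (arg k x).
Proof. by rewrite /cas arg_topp cosN sinN. Qed.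

Lemma measurable_arg k : measurable_fun [set: d.-tuple R] (arg k : d.-tuple R -> R).
Proof.
apply: measurable_funM => //; apply: measurable_sum => i.
by apply: measurable_funM => //; exact: measurable_tnth.
Qed.

Lemma bmeas_cas k : bmeas (cas k).
Proof.
by apply: bmeasD; [apply: bmeas_cos|apply: bmeas_sin]; exact: measurable_arg.
Qed.

Lemma arg_shift k x j : arg k (Defs.shift x j) = arg k x + 2 * pi * (\sum_(i < d) tnth k i * tnth j i)%:~R.
Proof.
rewrite /arg /kdot -mulrDr rmorph_sum -big_split; congr (_ * _).
by apply: eq_bigr => i _; rewrite tnth_mktuple mulrDr rmorphM.
Qed.

Lemma cas_periodic k : tperiodic (cas k).
Proof.
move=> x j; rewrite /cas arg_shift cosD sinD cos_int sin_int.
by rewrite !mulr1 !mulr0 subr0 addr0.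
Qed.

End Characters.

Section Orthogonality.
Variable R : realType.

Lemma arg_cons n (k : n.+1.-tuple int) (t : R) y :
  arg k (cons_tuple t y) =
  2 * pi * ((tnth k ord0)%:~R * t) + arg [tuple tnth k (lift ord0 i) | i < n] y.
Proof.
rewrite /arg /kdot big_ord_recl tnth0 mulrDr; congr (_ + _ * _).
by apply: eq_bigr => i _; rewrite tnth_mktuple tnthS.
Qed.

(** Both integrals go through one induction because the addition formulas, used to split off the
    first coordinate, mix cosine and sine. *)
Lemma rint_cos_sin d (k : d.-tuple int) :
  rint (fun x : d.-tuple R => cos (arg k x)) = (k == tzero d)%:R /\
  rint (fun x : d.-tuple R => sin (arg k x)) = 0.
Proof.
elim: d k => [|n IH] k.
  rewrite /= /arg /kdot big_ord0 mulr0 cos0 sin0.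
  by rewrite (_ : k == _)//; apply/eqP; apply: eq_from_tnth; case.
set k' := [tuple tnth k (lift ord0 i) | i < n].
have [c' s'] := IH k'.
have bc : bmeas (fun y : n.-tuple R => cos (arg k' y)) by apply: bmeas_cos; exact: measurable_arg.
have bs : bmeas (fun y : n.-tuple R => sin (arg k' y)) by apply: bmeas_sin; exact: measurable_arg.
have m0 : measurable_fun [set: R] (fun t : R => 2 * pi * ((tnth k ord0)%:~R * t) : R).
  by apply: measurable_funM => //; exact: measurable_funM.
have k0 : (k == tzero n.+1) = (tnth k ord0 == 0) && (k' == tzero n).
  apply/eqP/andP => [kE|[/eqP k0 /eqP k'0]].
    rewrite /k' kE; split; first by rewrite tnth_mktuple.
    by apply/eqP; apply: eq_from_tnth => i; rewrite !tnth_mktuple.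
  apply: eq_from_tnth => i; rewrite tnth_mktuple.
  case: (unliftP ord0 i) => [j ->|->]//.
  by have := congr1 (@tnth _ _ ^~ j) k'0; rewrite !tnth_mktuple.
split=> /=.
- rewrite (@eq_uint _ _ (fun t => (k' == tzero n)%:R * cos (2 * pi * ((tnth k ord0)%:~R * t)))).
    rewrite uintZ ?uint_cosM; last exact: bmeas_cos.
    by rewrite k0 -natrM mulnb andbC.
  move=> t _; under [X in rint X]funext do rewrite arg_cons cosD.
  by rewrite rintB ?rintZ// ?c' ?s' ?mulr0 ?subr0 1?mulrC//; exact: bmeasZ.
- rewrite (@eq_uint _ _ (fun t => (k' == tzero n)%:R * sin (2 * pi * ((tnth k ord0)%:~R * t)))).
    by rewrite uintZ ?uint_sinM ?mulr0//; exact: bmeas_sin.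
  move=> t _; under [X in rint X]funext do rewrite arg_cons sinD.
  by rewrite rintD ?rintZ// ?c' ?s' ?mulr0 ?addr0 1?mulrC//; exact: bmeasZ.
Qed.

Lemma rint_casM d (k j : d.-tuple int) :
  rint (fun x : d.-tuple R => cas k x * cas j x) = (k == j)%:R.
Proof.
rewrite (_ : (fun x => _) = fun x => cos (arg (tsub k j) x) + sin (arg (tadd k j) x)).
  rewrite rintD.
  - by have [-> _] := rint_cos_sin (tsub k j); have [_ ->] := rint_cos_sin (tadd k j);
      rewrite addr0 tsub_eq0.
  - by apply: bmeas_cos; exact: measurable_arg.
  - by apply: bmeas_sin; exact: measurable_arg.
by apply/funext => x; rewrite casM.
Qed.

Definition geod (d N : nat) (t : R) : pt R d := [tuple t * N%:R ^+ i | i < d].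

(** The frequency of the character [k] restricted to [geod]: its pairing with the direction (1, N,
    ..., N^(d-1)). *)
Definition freq d N (k : d.-tuple int) : int := \sum_(i < d) tnth k i * N%:Z ^+ i.

Lemma arg_geod d N (k : d.-tuple int) t :
  arg k (geod d N t) = 2 * pi * ((freq N k)%:~R * t).
Proof.
rewrite /arg /kdot /freq rmorph_sum mulr_suml; congr (_ * _).
apply: eq_bigr => i _; rewrite tnth_mktuple rmorphM rmorphXn/= -pmulrn.
by rewrite mulrCA mulrC.
Qed.

Lemma measurable_geod d N : measurable_fun [set: R] (geod d N : R -> d.-tuple R).
Proof.
apply/measurable_fun_tnthP => i; rewrite (_ : _ \o _ = fun t => t * N%:R ^+ i).
  exact: measurable_funM.
by apply/funext => t /=; rewrite tnth_mktuple.
Qed.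

Lemma bmeas_geod d N (f : d.-tuple R -> R) : bmeas f -> bmeas (fun t : R => f (geod d N t)).
Proof. by move=> bf; apply: (bmeas_comp _ bf); exact: measurable_geod. Qed.

Lemma uint_casM_geod d N (k j : d.-tuple int) :
  uint (fun t => cas k (geod d N t) * cas j (geod d N t)) = (freq N (tsub k j) == 0)%:R.
Proof.
rewrite (@eq_uint _ _ (fun t => cos (2 * pi * ((freq N (tsub k j))%:~R * t)) +
  sin (2 * pi * ((freq N (tadd k j))%:~R * t)))); last first.
  by move=> t _; rewrite casM !arg_geod.
have mf (m : int) : measurable_fun [set: R] (fun t : R => 2 * pi * (m%:~R * t) : R).
  by apply: measurable_funM => //; exact: measurable_funM.
by rewrite uintD ?uint_cosM ?uint_sinM ?addr0//; [exact: bmeas_cos|exact: bmeas_sin].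
Qed.

End Orthogonality.

(** * Lattice sums of Sobolev weights *)

Section FiniteSums.
Variable R : realType.

Lemma ler_sum_uniq_subset (I : eqType) (r r' : seq I) (F : I -> R) :
  uniq r -> {subset r <= r'} -> (forall i, 0 <= F i) ->
  \sum_(i <- r) F i <= \sum_(i <- r') F i.
Proof.
move=> + + F0; elim: r r' => [|x r IH] r' /=; first by rewrite big_nil sumr_ge0.
move=> /andP[xr ur] rr'; have xr' : x \in r' by rewrite rr'// mem_head.
rewrite big_cons (perm_big _ (perm_to_rem xr')) big_cons lerD2l; apply: IH => // y yr.
have := rr' y; rewrite inE yr orbT => /(_ isT); rewrite (perm_mem (perm_to_rem xr')) inE.
by case/predU1P => // yx; rewrite -yx yr in xr.
Qed.

(** Integral test by telescoping: with b = a - 1, b x^(-a) <= (x - 1)^(-b) - x^(-b), which follows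
    from two uses of exp u >= 1 + u, at u = -b ln(1 - 1/x) and at u = ln(1 - 1/x). *)
Lemma powR_sum_bound (a : R) : 1 < a ->
  forall M, \sum_(n < M) (n.+1%:R : R) `^ (- a) <= 1 + (a - 1)^-1.
Proof.
move=> a1; pose b := a - 1; have b0 : 0 < b by rewrite subr_gt0.
have step n : b * (n.+2%:R : R) `^ (- a) <= (n.+1%:R : R) `^ (- b) - (n.+2%:R : R) `^ (- b).
  set x : R := n.+2%:R.
  have x0 : 0 < x by rewrite ltr0n.
  have x1 : 1 < x by rewrite ltr1n.
  have -> : n.+1%:R = x * (1 - x^-1) :> R.
    by rewrite mulrBr mulr1 divff ?gt_eqF// /x -[in RHS]natr1 addrK.
  have y0 : 0 < 1 - x^-1 by rewrite subr_gt0 invf_lt1.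
  rewrite powRM ?(ltW x0) ?(ltW y0)// -{2}[x `^ (- b)]mulr1 -mulrBr.
  have -> : - a = - b - 1 by rewrite /b; ring.
  rewrite powRD; last by rewrite (gt_eqF x0) implybT.
  rewrite powR_inv1 ?(ltW x0)// mulrCA ler_wpM2l ?powR_ge0//.
  rewrite /powR (gt_eqF y0) lerBrDl; apply: le_trans (expR_ge1Dx _).
  rewrite lerD2l mulNr -mulrN ler_wpM2l ?(ltW b0)// lerNr.
  have := expR_ge1Dx (ln (1 - x^-1)); by rewrite lnK ?posrE// lerD2l.
case=> [|M]; first by rewrite big_ord0 addr_ge0// invr_ge0 ltW.
rewrite big_ord_recl/= powR1 lerD2l -(ler_pM2l b0) divff ?gt_eqF// mulr_sumr.
apply: (@le_trans _ _ (1 - (M.+1%:R : R) `^ (- b))); last by rewrite gerBl powR_ge0.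
elim: M => [|M IH]; first by rewrite big_ord0 powR1 subrr.
by rewrite big_ord_recr/=; have := step M; move: IH; lra.
Qed.

(* For [p > 1/2], the factors whose d-fold product dominates the Sobolev weights. *)
Definition jap (p : R) (m : int) : R := (1 + m%:~R ^+ 2) `^ (- p).

Lemma jap_ge0 p m : 0 <= jap p m.
Proof. exact: powR_ge0. Qed.

Lemma jap_nat_le (p : R) n : 0 <= p -> jap p n.+1 <= (n.+1%:R : R) `^ (- (2 * p)).
Proof.
move=> p0; rewrite /jap powRN -mulrN powRrM !powRN -!powR_mulrn// lef_pV2 ?posrE ?powR_gt0//.
by apply: ge0_ler_powR; rewrite ?nnegrE ?addr_ge0 ?sqr_ge0// lerDr.
Qed.

Lemma jap_sum_bound (p : R) : 1 / 2 < p ->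
  exists2 G : R, 0 <= G & forall B : seq int, uniq B -> \sum_(m <- B) jap p m <= G.
Proof.
move=> p2; have p0 : 0 <= p by lra.
pose G := 1 + (2 * p - 1)^-1 : R.
have G0 : 0 <= G by rewrite /G addr_ge0// invr_ge0; lra.
have sG M : \sum_(n < M) jap p n.+1 <= G.
  apply: (le_trans (ler_sum _ _) (powR_sum_bound _ M)); last by lra.
  by move=> n _; exact: jap_nat_le.
(* The term at 0 equals 1, and the positive and the negative integers contribute at most [G] each;
   [Negz n] stands for -(n + 1), so the second list misses 0. *)
exists (1 + G + G); first by rewrite addr_ge0// addr_ge0.
move=> B uB; pose M := \max_(m <- B) `|m|%N.
pose B' := [seq Posz n | n <- index_iota 0 M.+1] ++ [seq Negz n | n <- index_iota 0 M.+1].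
have BB' : {subset B <= B'}.
  move=> m mB; rewrite mem_cat.
  have : (`|m| <= M)%N by rewrite /M (big_rem _ mB)/= leq_maxl.
  case: m {mB} => n nM; apply/orP; [left|right].
    by apply: map_f; rewrite mem_index_iota.
  by apply: map_f; rewrite mem_index_iota ltnS; exact: ltnW nM.
apply: le_trans (ler_sum_uniq_subset uB BB' (jap_ge0 p)) _.
rewrite big_cat !big_map !big_mkord; apply: lerD.
  rewrite big_ord_recl; apply: lerD; last exact: sG.
  by rewrite /jap expr0n addr0 powR1.
rewrite (eq_bigr (fun n : 'I_M.+1 => jap p n.+1)); first exact: sG.
move=> n _.
by rewrite /jap NegzE mulrNz sqrrN.
Qed.

Fixpoint boxl n (B : seq int) : seq (n.-tuple int) :=
  if n is n'.+1 then [seq cons_tuple h t | h <- B, t <- boxl n' B] else [:: [tuple]].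

Lemma mem_boxl n B (k : n.-tuple int) : (forall i, tnth k i \in B) -> k \in boxl n B.
Proof.
elim: n k => [|n IH] k kB /=; first by rewrite inE; apply/eqP/eq_from_tnth; case.
case/tupleP: k kB => h t kB; apply: allpairs_f.
  by have := kB ord0; rewrite tnth0.
by apply: IH => i; have := kB (lift ord0 i); rewrite tnthS.
Qed.

(** Any finite set of tuples lies in a box B^n, over which the sum of products factors into n
    one-dimensional sums. *)
Lemma sum_prod_bound n (g : int -> R) (G : R) : (forall m, 0 <= g m) ->
  (forall B, uniq B -> \sum_(m <- B) g m <= G) ->
  forall F : seq (n.-tuple int), uniq F -> \sum_(k <- F) \prod_(i < n) g (tnth k i) <= G ^+ n.
Proof.
move=> g0 gG F uF.
pose B := undup (flatten (map (@tval n int) F)).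
have FB : {subset F <= boxl n B}.
  move=> k kF; apply: mem_boxl => i; rewrite mem_undup; apply/flattenP.
  by exists (tval k); [exact: map_f|exact: mem_tnth].
apply: le_trans (ler_sum_uniq_subset uF FB _) _; first by move=> k; exact: prodr_ge0.
have G0 : 0 <= G by apply: le_trans (gG [::] isT); rewrite big_nil.
have uB : uniq B by exact: undup_uniq.
clear FB uF; clearbody B; clear F; elim: n => [|n IH]; first by rewrite /= big_seq1 big_ord0.
rewrite [boxl _ _]/= big_allpairs_dep exprS.
rewrite (eq_bigr (fun h => g h * \sum_(t <- boxl n B) \prod_(i < n) g (tnth t i))).
  rewrite -mulr_suml ler_pM ?sumr_ge0//; last exact: gG.
  by move=> t _; exact: prodr_ge0.
move=> h _; rewrite mulr_sumr; apply: eq_bigr => t _.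
by rewrite big_ord_recl tnth0; congr (_ * _); apply: eq_bigr => i _; rewrite tnthS.
Qed.

(** The exponent [s] is shared equally among the [n] coordinates; s > n / 2 then leaves each of them
    an exponent above 1/2, the threshold of [jap_sum_bound]. *)
Lemma powRN_le_prod n (s Q : R) (a : 'I_n -> R) : (0 < n)%N -> 0 <= s ->
  (forall i, 0 < a i <= Q) -> Q `^ (- s) <= \prod_(i < n) a i `^ (- (s / n%:R)).
Proof.
move=> n0 s0 aQ.
have -> : Q `^ (- s) = \prod_(i < n) Q `^ (- (s / n%:R)).
  by rewrite prodr_const card_ord -powR_mulrn ?powR_ge0// -powRrM mulNr mulfVK// pnatr_eq0 -lt0n.
apply: ler_prod => i _; rewrite powR_ge0/= !powRN.
have /andP[a0 aQi] := aQ i; have Q0 := lt_le_trans a0 aQi.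
rewrite lef_pV2 ?posrE ?powR_gt0//.
by apply: ge0_ler_powR; rewrite ?nnegrE ?(ltW a0) ?(ltW Q0)// divr_ge0 ?ler0n.
Qed.

End FiniteSums.

(** * Sobolev weights on Z^d and on the lattice [freq N k = 0]; Peetre's inequality *)

Section SobolevWeights.
Context (R : realType).

Definition symb d (k : d.-tuple int) : R :=
  1 + 4 * pi ^+ 2 * \sum_(i < d) ((tnth k i)%:~R) ^+ 2.

Lemma pi2_ge4 : 4 <= pi ^+ 2 :> R.
Proof. by have := pi_ge2 R; have := pi_gt0 R; nra. Qed.

Lemma coord_le_symb d (k : d.-tuple int) i (c : R) :
  c <= (tnth k i)%:~R ^+ 2 -> 1 + 4 * pi ^+ 2 * c <= symb k.
Proof.
move=> ck; rewrite lerD2l; apply: ler_wpM2l; first by rewrite mulr_ge0 ?sqr_ge0.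
rewrite (bigD1 i)//=.
by rewrite (le_trans ck)// lerDl sumr_ge0// => j _; exact: sqr_ge0.
Qed.

Lemma symb_ge1 d (k : d.-tuple int) : 1 <= symb k.
Proof.
rewrite lerDl; apply: mulr_ge0; first by rewrite mulr_ge0 ?sqr_ge0.
by apply: sumr_ge0 => i _; exact: sqr_ge0.
Qed.

Lemma symb_gt0 d (k : d.-tuple int) : 0 < symb k.
Proof. exact: lt_le_trans (symb_ge1 k). Qed.

Lemma sob_weight_gt0 d s (k : d.-tuple int) : 0 < sob_weight s k :> R.
Proof. exact/powR_gt0/symb_gt0. Qed.

Lemma sob_weightN_sum_bound d (s : R) : (0 < d)%N -> d%:R / 2 < s ->
  exists2 C : R, 0 <= C &
    forall F : seq (d.-tuple int), uniq F -> \sum_(k <- F) (sob_weight s k)^-1 <= C.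
Proof.
move=> d0 ds; have d0' : 0 < d%:R :> R by rewrite ltr0n.
have s0 : 0 <= s by rewrite ltW// (le_lt_trans _ ds)// divr_ge0 ?ler0n.
have [G G0 sG] : exists2 G : R, 0 <= G &
    forall B : seq int, uniq B -> \sum_(m <- B) jap (s / d%:R) m <= G.
  by apply: jap_sum_bound; rewrite ltr_pdivlMr// mulrAC mul1r.
exists (G ^+ d); first exact: exprn_ge0.
move=> F uF; apply: le_trans (sum_prod_bound (jap_ge0 _) sG uF).
apply: ler_sum => k _; rewrite -powRN; apply: powRN_le_prod => // i.
rewrite ltr_pwDl ?sqr_ge0//=; apply: le_trans (@coord_le_symb _ _ i _ (lexx _)).
rewrite lerD2l ler_peMl ?sqr_ge0//; have := pi2_ge4; lra.
Qed.

(* [horner_tail N k i = sum_(j >= i) k_j N^(j - i)]: on the lattice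
   [freq N k = 0], these d - 1 integers are coordinates in the basis
   [N e_(i-1) - e_i], up to sign. *)
Definition horner_tail N d (k : d.-tuple int) (i : nat) : int :=
  foldr (fun a b => a + N%:Z * b) 0 (drop i k).

Lemma horner_tail_step N d (k : d.-tuple int) (i : 'I_d) :
  tnth k i = horner_tail N k i - N%:Z * horner_tail N k i.+1.
Proof.
rewrite /horner_tail (drop_nth 0) ?size_tuple//= addrK (tnth_nth 0)//.
Qed.

Lemma horner_tail_size N d (k : d.-tuple int) : horner_tail N k d = 0.
Proof. by rewrite /horner_tail drop_oversize// size_tuple. Qed.

Lemma horner_tail0 N d (k : d.-tuple int) : horner_tail N k 0 = freq N k.
Proof.
rewrite /horner_tail drop0 /freq; elim: d k => [|d IH] k.
  by rewrite big_ord0 tuple0.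
case/tupleP: k => a k; rewrite /= IH big_ord_recl tnth0 expr0 mulr1 mulr_sumr.
by congr (_ + _); apply: eq_bigr => i _; rewrite tnthS exprS mulrCA.
Qed.

(** Let M be the largest absolute value of a tail with index at least 1, attained at [i0.+1]. Since
    [freq N k = 0] makes the zeroth tail vanish, M bounds all tails, so the coordinate [i0], a tail
    minus N times a tail of size M, has size at least (N - 1) M. M >= 1, as otherwise all tails and
    with them [k] would vanish. Finally N <= 2 (N - 1), and the factor 4 pi^2 in [symb] absorbs the
    loss. *)
Lemma lattice_symb_ge n N (k : n.+2.-tuple int) : (2 <= N)%N ->
  freq N k = 0 -> k != tzero n.+2 ->
  forall i : 'I_n.+1, N%:R ^+ 2 * (1 + (horner_tail N k i.+1)%:~R ^+ 2) <= symb k.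
Proof.
move=> N2 k0 kn0 i.
pose c (j : 'I_n.+1) := `|horner_tail N k j.+1|%N.
have [i0 _ i0max] := arg_maxnP c (isT : xpredT (ord0 : 'I_n.+1)).
set M := c i0.
have cM j : (`|horner_tail N k j| <= M)%N.
  case: j => [|j]; first by rewrite horner_tail0 k0.
  have [jn|jn] := ltnP j n.+1; first exact: (i0max (Ordinal jn)).
  by rewrite /horner_tail drop_oversize// size_tuple.
have M1 : (1 <= M)%N.
  rewrite lt0n; apply: contraNneq kn0 => M0; apply/eqP/eq_from_tnth => j.
  rewrite tnth_mktuple (horner_tail_step N).
  have /eqP -> : horner_tail N k j == 0 by rewrite -absz_eq0 -leqn0 -M0 cM.
  have /eqP -> : horner_tail N k j.+1 == 0 by rewrite -absz_eq0 -leqn0 -M0 cM.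
  by rewrite mulr0 subr0.
pose x : R := M%:R; pose y : R := N%:R.
have x1 : 1 <= x by rewrite ler1n.
have y2 : 2 <= y by rewrite ler_nat.
have normE (m : int) : `|m%:~R| = `|m|%N%:R :> R by rewrite -intr_norm natr_absz.
have sq_le j : (horner_tail N k j)%:~R ^+ 2 <= x ^+ 2.
  by rewrite -real_normK ?num_real// normE ler_sqr ?nnegrE ?ler0n// ler_nat.
pose l : 'I_n.+2 := widen_ord (leqnSn _) i0.
have kl : ((y - 1) * x) ^+ 2 <= (tnth k l)%:~R ^+ 2.
  rewrite -[leRHS]real_normK ?num_real// ler_sqr ?nnegrE//; last first.
    by rewrite mulr_ge0//; lra.
  rewrite (horner_tail_step N) intrB intrM/= -pmulrn distrC.
  apply: le_trans (lerB_dist _ _); rewrite normrM !normE normr_nat -/M -/x -/y.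
  have : `|horner_tail N k i0|%N%:R <= x by rewrite ler_nat.
  lra.
apply: le_trans (coord_le_symb kl).
apply: (@le_trans _ _ (y ^+ 2 * (1 + x ^+ 2))).
  by rewrite ler_wpM2l ?sqr_ge0// lerD2l.
have yx : (y * x) ^+ 2 <= 4 * ((y - 1) * x) ^+ 2.
  rewrite (_ : 4 * _ = (2 * (y - 1) * x) ^+ 2); last by ring.
  by rewrite ler_sqr ?nnegrE; nra.
have y2x : y ^+ 2 <= (y * x) ^+ 2 by rewrite exprMn ler_peMr ?sqr_ge0//; nra.
have := pi2_ge4; move: y2x yx; rewrite exprMn.
set a := y ^+ 2; set b := x ^+ 2; set e := _ ^+ 2; set p := pi ^+ 2 => ab be p4.
have e0 : 0 <= e by exact: sqr_ge0.
have : 4 * e <= p * e by rewrite ler_wpM2r.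
lra.
Qed.

(** On the lattice the tails of index 1 to d - 1 determine [k], so the sum runs injectively over
    points of Z^(d-1). Taking N^2 out of [symb] by [lattice_symb_ge] produces the factor N^(-2s);
    the rest is shared among d - 1 coordinates, each with exponent s / (d - 1) > 1/2. *)
Lemma lattice_sum_bound n (s : R) : n.+2%:R / 2 < s ->
  exists2 C : R, 0 <= C & forall N, (2 <= N)%N ->
    forall F : seq (n.+2.-tuple int), uniq F ->
    (forall k, k \in F -> freq N k = 0 /\ k != tzero n.+2) ->
    \sum_(k <- F) (sob_weight s k)^-1 <= C * (N%:R `^ (- s)) ^+ 2.
Proof.
move=> ds.
have s0 : 0 <= s by rewrite ltW// (le_lt_trans _ ds)// divr_ge0 ?ler0n.
have [G G0 sG] : exists2 G : R, 0 <= G &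
    forall B : seq int, uniq B -> \sum_(m <- B) jap (s / n.+1%:R) m <= G.
  apply: jap_sum_bound; rewrite ltr_pdivlMr ?ltr0n// mulrAC mul1r.
  by apply: le_lt_trans ds; rewrite ler_pM2r ?invr_gt0// ler_nat.
exists (G ^+ n.+1); first exact: exprn_ge0.
move=> N N2 F uF F0.
pose c (k : n.+2.-tuple int) : n.+1.-tuple int := [tuple horner_tail N k i.+1 | i < n.+1].
have ucF : uniq [seq c k | k <- F].
  rewrite map_inj_in_uniq// => k j /F0[k0 _] /F0[j0 _] ckj.
  have e i : (i <= n.+2)%N -> horner_tail N k i = horner_tail N j i.
    case: i => [_|i]; first by rewrite !horner_tail0 k0 j0.
    rewrite ltnS leq_eqVlt => /predU1P[->|i1]; first by rewrite !horner_tail_size.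
    by have := congr1 (@tnth _ _ ^~ (Ordinal i1)) ckj; rewrite !tnth_mktuple.
  by apply: eq_from_tnth => i; rewrite !(horner_tail_step N) !e// ltnW.
rewrite mulrC; have := sum_prod_bound (jap_ge0 _) sG ucF; rewrite big_map => sc.
apply: le_trans (ler_wpM2l (sqr_ge0 _) sc); rewrite mulr_sumr big_seq [leRHS]big_seq.
apply: ler_sum => k kF; have [k0 kn0] := F0 _ kF; rewrite -powRN.
have N0 : 0 < N%:R :> R by rewrite ltr0n (leq_trans _ N2).
have q0 := symb_gt0 k; set q := symb k in q0.
have -> : q `^ (- s) = (N%:R `^ (- s)) ^+ 2 * (q / N%:R ^+ 2) `^ (- s).
  rewrite expr2 -powRM ?(ltW N0)// -powRM; [|by rewrite mulr_ge0 ?ltW|].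
    by rewrite -expr2 mulrC divfK// sqrf_eq0 gt_eqF.
  by rewrite divr_ge0 ?sqr_ge0// ltW.
rewrite ler_wpM2l ?sqr_ge0//; apply: powRN_le_prod => // i; rewrite tnth_mktuple.
rewrite ltr_pwDl ?sqr_ge0//= ler_pdivlMr ?exprn_gt0// mulrC.
exact: lattice_symb_ge.
Qed.

(** From (a - b)^2 <= 2 (a^2 + b^2), [symb] of a difference is at most 2 (symb k + symb j), hence at
    most 4 times the larger of the two, and the power s / 2 is monotone. *)
Lemma peetre_symb d s (k j : d.-tuple int) : 0 <= s ->
  symb (tsub k j) `^ (s / 2) <= 4 `^ (s / 2) * (symb k `^ (s / 2) + symb j `^ (s / 2)).
Proof.
move=> s0; have s2 : 0 <= s / 2 by rewrite divr_ge0.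
have kj : symb (tsub k j) <= 2 * (symb k + symb j).
  have : \sum_(i < d) (tnth (tsub k j) i)%:~R ^+ 2 <=
      2 * (\sum_(i < d) (tnth k i)%:~R ^+ 2 + \sum_(i < d) (tnth j i)%:~R ^+ 2) :> R.
    rewrite -big_split/= mulr_sumr; apply: ler_sum => i _; rewrite tnth_mktuple intrB.
    move: (_%:~R : R) (_%:~R : R) => a b.
    by have := sqr_ge0 (a + b); rewrite sqrrD sqrrB; lra.
  have p0 : 0 <= 4 * pi ^+ 2 :> R by rewrite mulr_ge0 ?sqr_ge0.
  by move=> /(ler_wpM2l p0); rewrite /symb mulrCA mulrDr; lra.
have [km|jm] := leP (symb j) (symb k).
  rewrite mulrDr; apply: le_trans (_ : _ <= 4 `^ (s / 2) * symb k `^ (s / 2)) _; last first.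
    by rewrite lerDl mulr_ge0 ?powR_ge0.
  rewrite -powRM ?(ltW (symb_gt0 _))//.
  apply: ge0_ler_powR; rewrite ?nnegrE ?mulr_ge0 ?(ltW (symb_gt0 _))//; lra.
rewrite mulrDr; apply: le_trans (_ : _ <= 4 `^ (s / 2) * symb j `^ (s / 2)) _; last first.
  by rewrite lerDr mulr_ge0 ?powR_ge0.
rewrite -powRM ?(ltW (symb_gt0 _))//.
apply: ge0_ler_powR; rewrite ?nnegrE ?mulr_ge0 ?(ltW (symb_gt0 _))//; lra.
Qed.

End SobolevWeights.

(** * The bilinear sum over aliased pairs of frequencies *)

Section AliasingBound.
Variable R : realType.

Definition alias d N (k j : d.-tuple int) : bool :=
  (freq N (tsub k j) == 0) && (tsub k j != tzero d).

Lemma tsub_injl d (j : d.-tuple int) : injective (fun k => tsub k j).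
Proof.
move=> k k' /(congr1 (@tnth _ _ ^~ _)) e; apply: eq_from_tnth => i.
by have := e i; rewrite !tnth_mktuple => /addIr.
Qed.

Lemma tsub_injr d (k : d.-tuple int) : injective (tsub k).
Proof.
move=> j j' /(congr1 (@tnth _ _ ^~ _)) e; apply: eq_from_tnth => i.
by have := e i; rewrite !tnth_mktuple => /addrI /oppr_inj.
Qed.

Lemma amgm (nu x y : R) : 0 < nu -> x * y <= (x ^+ 2 / nu + nu * y ^+ 2) / 2.
Proof.
move=> nu0; rewrite ler_pdivlMr// -(ler_pM2r nu0).
rewrite mulrDl divfK ?gt_eqF//; have := sqr_ge0 (x - nu * y); nra.
Qed.

Lemma sob_weight_sqr d s (k : d.-tuple int) :
  sob_weight s k = (symb R k `^ (s / 2)) ^+ 2 :> R.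
Proof.
rewrite expr2 -powRD; last by rewrite (gt_eqF (symb_gt0 R k)) implybT.
by rewrite -splitr.
Qed.

(** Peetre's inequality transfers the weight of [tsub k j] to one of the two factors, say [h k]. For
    fixed [j] the sum over [k] of W / nu + nu * H is O(nu), because the lattice sum of W is O(nu^2):
    this balance dictates the choice of nu. The other factor [|g j|] is summed by the l^1 bound. The
    symmetric half exchanges the roles of [k] and [j]. *)
Lemma alias_sum_bound n (s A : R) : n.+2%:R / 2 < s -> 0 <= A ->
  exists2 C : R, 0 <= C & forall N, (2 <= N)%N ->
    forall (F : seq (n.+2.-tuple int)) (h g : n.+2.-tuple int -> R), uniq F ->
    \sum_(k <- F) sob_weight s k * h k ^+ 2 <= A ->
    \sum_(k <- F) sob_weight s k * g k ^+ 2 <= A ->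
    \sum_(k <- F) \sum_(j <- F | alias N k j) `|h k| * `|g j| <= C * N%:R `^ (- s).
Proof.
move=> ds A0.
have s0 : 0 <= s by rewrite ltW// (le_lt_trans _ ds)// divr_ge0 ?ler0n.
have [Cq Cq0 sCq] := sob_weightN_sum_bound (ltn0Sn n.+1) ds.
have [Cl Cl0 sCl] := lattice_sum_bound ds.
pose P : R := 4 `^ (s / 2).
exists (P / 2 * (Cl + A) * (Cq + A)).
  by rewrite !mulr_ge0 ?addr_ge0 ?powR_ge0.
move=> N N2 F h g uF hA gA.
set nu : R := N%:R `^ (- s).
have nu0 : 0 < nu by rewrite powR_gt0 // ltr0n (leq_trans _ N2).
(* The coefficients are absolutely summable: [amgm] with the weight itself as parameter leaves the
   sum of inverse weights, bounded since s > d / 2. *)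
have l1 (f : n.+2.-tuple int -> R) : \sum_(k <- F) sob_weight s k * f k ^+ 2 <= A ->
    \sum_(k <- F) `|f k| <= (Cq + A) / 2.
  move=> fA; apply: (@le_trans _ _ (\sum_(k <- F)
      ((sob_weight s k)^-1 + sob_weight s k * f k ^+ 2) / 2)).
    apply: ler_sum => k _; have := @amgm (sob_weight s k) 1 `|f k| (sob_weight_gt0 s k).
    by rewrite mul1r expr1n div1r real_normK ?num_real.
  by rewrite -mulr_suml big_split/= ler_pM2r ?invr_gt0// lerD// sCq.
have lat (f : n.+2.-tuple int -> n.+2.-tuple int) : injective f ->
    \sum_(k <- F | (freq N (f k) == 0) && (f k != tzero n.+2)) (sob_weight s (f k))^-1
      <= Cl * nu ^+ 2.
  move=> fI; rewrite -big_filter -(big_map f xpredT (fun l => (sob_weight s l)^-1)).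
  apply: sCl => //; first by rewrite map_inj_uniq// filter_uniq.
  by move=> l /mapP[k]; rewrite mem_filter => /andP[/andP[/eqP ? ?] _] ->.
have half (f : n.+2.-tuple int -> R) (p : pred (n.+2.-tuple int)) (u : n.+2.-tuple int -> R) :
    \sum_(k <- F) sob_weight s k * f k ^+ 2 <= A ->
    \sum_(k <- F | p k) u k <= Cl * nu ^+ 2 ->
    \sum_(k <- F | p k) (u k / nu + nu * (sob_weight s k * f k ^+ 2)) <= (Cl + A) * nu.
  move=> fA uC; rewrite big_split/= mulrDl; apply: lerD.
    rewrite -mulr_suml ler_pdivrMr// -mulrA -expr2//.
  rewrite -mulr_sumr mulrC ler_pM2r//; apply: le_trans fA.
  rewrite [leRHS](bigID p)/= lerDl sumr_ge0// => k _.
  by rewrite mulr_ge0 ?sqr_ge0// ltW// sob_weight_gt0.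
pose W (k j : n.+2.-tuple int) : R := (sob_weight s (tsub k j))^-1.
pose H k : R := sob_weight s k * h k ^+ 2; pose G k : R := sob_weight s k * g k ^+ 2.
have term k j : alias N k j -> `|h k| * `|g j| <=
    P / 2 * ((W k j / nu + nu * H k) * `|g j| + (W k j / nu + nu * G j) * `|h k|).
  move=> _; set Q := fun k : n.+2.-tuple int => symb R k `^ (s / 2) : R.
  have Q0 l : 0 < Q l by apply: powR_gt0; exact: symb_gt0.
  have am l (f : n.+2.-tuple int -> R) : (Q (tsub k j))^-1 * (Q l * `|f l|) <=
      (W k j / nu + nu * (sob_weight s l * f l ^+ 2)) / 2.
    apply: le_trans (amgm _ _ nu0) _.
    by rewrite exprMn real_normK ?num_real// exprVn /W !sob_weight_sqr.
  have := am k h; have := am j g; rewrite -/(H k) -/(G j).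
  move=> /(ler_wpM2r (normr_ge0 (h k))) ag /(ler_wpM2r (normr_ge0 (g j))) ah.
  have := ler_wpM2l (powR_ge0 4 (s / 2)) (lerD ah ag); rewrite -/P => b.
  have -> : P / 2 * ((W k j / nu + nu * H k) * `|g j| + (W k j / nu + nu * G j) * `|h k|)
    = P * ((W k j / nu + nu * H k) / 2 * `|g j| + (W k j / nu + nu * G j) / 2 * `|h k|).
    by ring.
  apply: le_trans b.
  have -> : P * ((Q (tsub k j))^-1 * (Q k * `|h k|) * `|g j| +
      (Q (tsub k j))^-1 * (Q j * `|g j|) * `|h k|) =
    (Q (tsub k j))^-1 * (P * (Q k + Q j)) * (`|h k| * `|g j|) by ring.
  (* What remains is that the factor in front of |h k| |g j| is at least 1, which is Peetre's
     inequality divided by [Q (tsub k j)]. *)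
  rewrite ler_peMl ?mulr_ge0// mulrC ler_pdivlMr// mul1r.
  exact: peetre_symb.
apply: (@le_trans _ _ (\sum_(k <- F) \sum_(j <- F | alias N k j)
    P / 2 * ((W k j / nu + nu * H k) * `|g j| + (W k j / nu + nu * G j) * `|h k|))).
  by apply: ler_sum => k _; apply: ler_sum => j; exact: term.
have -> : P / 2 * (Cl + A) * (Cq + A) * nu =
    P / 2 * ((Cl + A) * nu * ((Cq + A) / 2) + (Cl + A) * nu * ((Cq + A) / 2)) by field.
under eq_bigr do rewrite -mulr_sumr big_split/=.
rewrite -mulr_sumr ler_wpM2l ?divr_ge0 ?powR_ge0// big_split/=.
have ClA : 0 <= (Cl + A) * nu by rewrite mulr_ge0 ?addr_ge0// ltW.
apply: lerD.
- rewrite (exchange_big_dep xpredT)//=; apply: le_trans (ler_wpM2l ClA (l1 _ gA)).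
  rewrite mulr_sumr; apply: ler_sum => j _; rewrite -mulr_suml ler_wpM2r//.
  by apply: half => //; apply: (lat (fun k => tsub k j)); exact: tsub_injl.
- apply: le_trans (ler_wpM2l ClA (l1 _ hA)).
  rewrite mulr_sumr; apply: ler_sum => k _; rewrite -mulr_suml ler_wpM2r//.
  by apply: half => //; apply: (lat (tsub k)); exact: tsub_injr.
Qed.

End AliasingBound.

(** * Continuity on the torus and the reproducing kernel *)

Section TorusContinuity.
Context (R : realType) (d : nat).
Implicit Types (x y : pt R d) (f g : pt R d -> R).

Lemma sqrt_sum_sqr_le (a : 'I_d -> R) :
  Num.sqrt (\sum_i a i ^+ 2) <= \sum_i `|a i|.
Proof.
have S0 : 0 <= \sum_i `|a i| by exact: sumr_ge0.
rewrite -(ger0_norm S0) -sqrtr_sqr; apply: ler_wsqrtr.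
rewrite expr2 mulr_suml; apply: ler_sum => i _; rewrite -real_normK ?num_real// expr2.
by rewrite ler_wpM2l// (bigD1 i)//= lerDl sumr_ge0.
Qed.

Lemma tdist_has_lb x y : has_lbound
  [set Num.sqrt (\sum_(i < d) (tnth x i - tnth y i - (tnth k i)%:~R) ^+ 2)
      | k in [set: d.-tuple int]].
Proof. by exists 0 => _ [k _ <-]; exact: sqrtr_ge0. Qed.

Lemma tdist_le x y : tdist x y <= \sum_i `|tnth x i - tnth y i|.
Proof.
apply: le_trans (sqrt_sum_sqr_le _); apply: ge_inf; first exact: tdist_has_lb.
exists (tzero d) => //; congr Num.sqrt; apply: eq_bigr => i _.
by rewrite tnth_mktuple subr0.
Qed.

Lemma tdist_ge0 x y : 0 <= tdist x y.
Proof.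
apply: lb_le_inf; last by move=> _ [k _ <-]; exact: sqrtr_ge0.
by eexists; exists (tzero d).
Qed.

Lemma tdist_shift x (k : d.-tuple int) : tdist x (Defs.shift x k) = 0.
Proof.
apply/eqP; rewrite eq_le tdist_ge0 andbT; apply: ge_inf; first exact: tdist_has_lb.
exists (topp k) => //; rewrite big1 ?sqrtr0// => i _.
by rewrite !tnth_mktuple mulrNz opprK opprD addrA subrr add0r addNr expr0n.
Qed.

(** Continuity of the lift to R^d, tested coordinate by coordinate: convenient for trigonometric
    functions, and implied by continuity for [tdist] through [tdist_tcont]. *)
Definition tcont f := forall x (e : R), 0 < e -> exists2 del : R, 0 < del &
  forall y, (forall i, `|tnth x i - tnth y i| < del) -> `|f y - f x| < e.

Lemma tdist_tcont f :
  (forall x (e : R), 0 < e -> exists2 del : R, 0 < del &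
    forall y, tdist x y < del -> `|f y - f x| < e) -> tcont f.
Proof.
move=> cf x e /(cf x)[del del0 fdel].
have d1 : 0 < d.+1%:R :> R by rewrite ltr0n.
exists (del / d.+1%:R); first by rewrite divr_gt0.
move=> y xy; apply: fdel; apply: le_lt_trans (tdist_le x y) _.
apply: (@le_lt_trans _ _ (\sum_(i < d) (del / d.+1%:R))).
  by apply: ler_sum => i _; exact: ltW.
rewrite sumr_const card_ord -[_ *+ d]mulr_natr -mulrA gtr_pMr// mulrC ltr_pdivrMr// mul1r.
by rewrite ltr_nat.
Qed.

Lemma tcont_cst c : tcont (fun=> c).
Proof. by move=> x e e0; exists 1 => // y _; rewrite subrr normr0. Qed.

Lemma tcontD f g : tcont f -> tcont g -> tcont (fun x => f x + g x).
Proof.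
move=> cf cg x e e0; have e2 : 0 < e / 2 by rewrite divr_gt0.
have [a a0 fa] := cf x _ e2; have [b b0 gb] := cg x _ e2.
exists (Num.min a b); first by rewrite lt_min a0.
move=> y xy; rewrite opprD addrACA (splitr e); apply: le_lt_trans (ler_normD _ _) _.
by apply: ltrD; [apply: fa|apply: gb] => i; have := xy i; rewrite lt_min => /andP[].
Qed.

Lemma tcontZ c f : tcont f -> tcont (fun x => c * f x).
Proof.
move=> cf x e e0; have c0 : 0 < `|c| + 1 by rewrite ltr_wpDl.
have [a a0 fa] := cf x _ (divr_gt0 e0 c0); exists a => // y xy.
rewrite -mulrBr normrM; have := fa y xy; rewrite ltr_pdivlMr// mulrC; apply: le_lt_trans.
by rewrite ler_wpM2r// lerDl.
Qed.

Lemma tcontB f g : tcont f -> tcont g -> tcont (fun x => f x - g x).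
Proof.
move=> cf cg; have := tcontD cf (tcontZ (-1) cg).
by under eq_fun do rewrite mulN1r.
Qed.

Lemma tcont_norm f : tcont f -> tcont (fun x => `|f x|).
Proof.
move=> cf x e e0; have [a a0 fa] := cf x e e0; exists a => // y xy.
exact: le_lt_trans (ler_dist_dist _ _) (fa y xy).
Qed.

Lemma tcont_sum (I : Type) (r : seq I) (f : I -> pt R d -> R) :
  (forall i, tcont (f i)) -> tcont (fun x => \sum_(i <- r) f i x).
Proof.
move=> cf; elim: r => [|i r IH].
  by under eq_fun do rewrite big_nil; exact: tcont_cst.
by under eq_fun do rewrite big_cons; exact: tcontD.
Qed.

Lemma tcont_comp (g : R -> R) f : continuous g -> tcont f -> tcont (fun x => g (f x)).
Proof.
move=> cg cf x e e0; have /cvgrPdist_lt/(_ e e0)/nbhs_ballP[a a0 ga] := cg (f x).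
have [b b0 fb] := cf x a a0; exists b => // y xy.
by rewrite distrC; apply: ga; rewrite /ball/= distrC; exact: fb.
Qed.

Lemma tcont_coord i : tcont (fun x => tnth x i).
Proof. by move=> x e e0; exists e => // y; rewrite distrC; exact. Qed.

Lemma tcont_cas k : tcont (cas k).
Proof.
have carg : tcont (arg k).
  by apply/tcontZ/tcont_sum => i; apply: tcontZ; exact: tcont_coord.
by apply: tcontD; apply: tcont_comp => //; [exact: continuous_cos|exact: continuous_sin].
Qed.

Lemma tcont_bounded_cube f : tcont f -> exists M : R, forall x, cube x -> `|f x| <= M.
Proof.
(* Compactness of the cube is taken from row vectors, to which [f] is transported by [vec]. *)
move=> cf; pose vec (v : 'rV[R]_d) : pt R d := [tuple v ord0 i | i < d].
have cfv : continuous (f \o vec).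
  move=> v B /nbhs_ballP[e e0 eB]; have [a a0 fa] := cf (vec v) e e0.
  apply/nbhs_ballP; exists a => // w vw; apply: eB; rewrite /ball/= distrC.
  by apply: fa => i; rewrite !tnth_mktuple; case: vw => _ /(_ ord0 i).
have cA := @rV_compact R d (fun=> `[0, 1]%classic) (fun=> @segment_compact R 0 1).
have := continuous_compact (continuous_subspaceT cfv) cA.
move=> /compact_bounded[M [_ fM]].
exists (M + 1) => x cx; apply: (fM (M + 1)); first by rewrite ltrDl.
exists (\row_i tnth x i); first by move=> i; rewrite mxE /= in_itv/=; exact: cx.
rewrite /=; congr f; apply: eq_from_tnth => i; by rewrite tnth_mktuple mxE.
Qed.

Lemma cube_repr x : exists2 k : d.-tuple int, cube (Defs.shift x k) &
  forall f, tperiodic f -> f x = f (Defs.shift x k).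
Proof.
exists [tuple - Num.floor (tnth x i) | i < d]; last by move=> f pf; rewrite pf.
move=> i; rewrite !tnth_mktuple mulrNz /unit_itv/= subr_ge0 floor_le/=.
by rewrite lerBlDr addrC -[1]/(1%:~R) -intrD; exact/ltW/floorD1_gt.
Qed.

Lemma tcont_bounded f : tperiodic f -> tcont f -> exists M : R, forall x, `|f x| <= M.
Proof.
move=> pf /tcont_bounded_cube[M fM]; exists M => x.
by have [k ck ->//] := cube_repr x; exact: fM.
Qed.

Lemma tcont_rint_eq0 f : tperiodic f -> tcont f -> bmeas (f : d.-tuple R -> R) ->
  (forall x, 0 <= f x) -> rint f = 0 -> forall x, f x = 0.
Proof.
move=> pf cf bf f0 fi x; have [k ck ->//] := cube_repr x.
set y := Defs.shift x k in ck *; apply/eqP; rewrite eq_le f0 andbT leNgt; apply/negP => fy.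
have fy2 : 0 < f y / 2 by rewrite divr_gt0.
have [a a0 fa] := cf y _ fy2.
(* Halving [a] makes the closed box fit the strict inequality of [fa]; the bound 1 / 2 lets a box of
   side [eta] fit in the cube next to any of its points. *)
pose eta := Num.min (a / 2) (1 / 2).
have e0 : 0 < eta by rewrite lt_min !divr_gt0.
have : f y / 2 * eta ^+ d <= rint f.
  apply: (@rint_ge_box _ _ _ _ y) => //; first exact: ltW.
    by rewrite ge_min lexx orbT.
  move=> z cz zy; have : `|f z - f y| < f y / 2.
    apply: fa => i; rewrite distrC; apply: le_lt_trans (zy i) _.
    by rewrite gt_min ltr_pdivrMr// ltr_pMr ?ltr1n.
  by rewrite ltr_norml => /andP[? _]; lra.
by rewrite fi leNgt mulr_gt0// exprn_gt0.
Qed.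

(** Turns the almost everywhere equality in [HK_eq_Hs] into equality of functions: a continuous
    nonnegative function with zero integral vanishes. *)
Lemma ae_eq_tcont f g : tperiodic f -> tperiodic g -> tcont f -> tcont g ->
  bmeas (f : d.-tuple R -> R) -> bmeas (g : d.-tuple R -> R) -> Defs.ae_eq f g -> f = g.
Proof.
move=> pf pg cf cg bf bg; have bfg : bmeas (fun x : d.-tuple R => `|f x - g x|).
  exact: (bmeas_norm (bmeasB bf bg)).
rewrite /Defs.ae_eq tint_EFin// => -[fg]; apply/funext => x; apply/eqP.
rewrite -subr_eq0 -normr_eq0; apply/eqP.
apply: (@tcont_rint_eq0 (fun x => `|f x - g x|)) => //.
- by move=> y k; rewrite pf pg.
- exact/tcont_norm/tcontB.
Qed.

End TorusContinuity.

Section ReproducingKernel.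
Context (R : realType) (d : nat) (K : pt R d -> pt R d -> R) (H : set (pt R d -> R))
  (ip : (pt R d -> R) -> (pt R d -> R) -> R).
Context (rk : is_RKHS K H ip) (Kper : kernel_periodic K) (Kcont : kernel_continuous K).
Implicit Types f g : pt R d -> R.

Lemma rk_ip_linr a f g h : H f -> H g -> H h ->
  ip h (fun x => a * f x + g x) = a * ip h f + ip h g.
Proof.
move=> Hf Hg Hh; rewrite (rk_sym rk Hh); last exact: (rk_lin rk).
by rewrite (rk_ip_lin rk)// (rk_sym rk Hf Hh) (rk_sym rk Hg Hh).
Qed.

Lemma rk_ip_sqr t f g : H f -> H g ->
  ip (fun x => t * f x + g x) (fun x => t * f x + g x) =
  t ^+ 2 * ip f f + 2 * t * ip f g + ip g g.
Proof.
move=> Hf Hg; have Hh : H (fun x => t * f x + g x) by exact: (rk_lin rk).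
rewrite (rk_ip_lin rk)// rk_ip_linr// rk_ip_linr// (rk_sym rk Hg Hf); ring.
Qed.

Lemma rk_cauchy_schwarz f g : H f -> H g -> ip f g ^+ 2 <= ip f f * ip g g.
Proof.
move=> Hf Hg; have pos t : 0 <= t ^+ 2 * ip f f + 2 * t * ip f g + ip g g.
  by rewrite -rk_ip_sqr//; apply: (rk_pos rk); exact: (rk_lin rk).
have := rk_pos rk Hf; rewrite le_eqVlt => /predU1P[f0|f0].
  have -> : ip f g = 0; last by rewrite -f0 expr0n mul0r.
  apply/eqP; apply/negPn/negP => fg0.
  (* For [ip f f = 0] the quadratic is affine in t, and this t would make it equal to -1. *)
  have := pos (- (ip g g + 1) / (2 * ip f g)); rewrite -f0 mulr0 add0r.
  have -> : 2 * (- (ip g g + 1) / (2 * ip f g)) * ip f g = - (ip g g + 1) by field.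
  lra.
have := pos (- ip f g / ip f f).
have -> : (- ip f g / ip f f) ^+ 2 * ip f f + 2 * (- ip f g / ip f f) * ip f g + ip g g =
  ip g g - ip f g ^+ 2 / ip f f by field; rewrite gt_eqF.
by rewrite subr_ge0 ler_pdivrMr// mulrC.
Qed.

Lemma rk_eval_le f x : H f -> f x ^+ 2 <= ip f f * K x x.
Proof.
move=> Hf; rewrite -(rk_reproducing rk x Hf); apply: le_trans (rk_cauchy_schwarz Hf (rk_kernel rk x)) _.
by rewrite (rk_reproducing rk x (rk_kernel rk x)).
Qed.

(** By reproduction, f y - f x is the inner product of f with K y - K x, whose squared norm K x x -
    2 K y x + K y y is small because all its entries are close to K x x. The 1 in [ip f f + 1] keeps
    the divisor positive when f = 0. *)
Lemma rk_tcont f : H f -> tcont f.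
Proof.
move=> Hf; apply: tdist_tcont => x e e0.
have p0 : 0 < 4 * (ip f f + 1) by rewrite mulr_gt0// ltr_wpDl// (rk_pos rk).
have e1 : 0 < e ^+ 2 / (4 * (ip f f + 1)) by rewrite divr_gt0// exprn_gt0.
have [a a0 Ka] := Kcont x x e1; exists a => // y xy.
have Hd : H (fun z => -1 * K x z + K y z) by apply: (rk_lin rk); exact: (rk_kernel rk).
have fxy : f y - f x = ip f (fun z => -1 * K x z + K y z).
  rewrite rk_ip_linr//; try exact: (rk_kernel rk).
  by rewrite !(rk_reproducing rk)// mulN1r addrC.
have x0 : tdist x x < a.
  by have := tdist_shift x (tzero d); rewrite (_ : Defs.shift _ _ = x) => [->//|];
    apply: eq_from_tnth => i; rewrite !tnth_mktuple addr0.
have := rk_cauchy_schwarz Hf Hd; rewrite -fxy rk_ip_sqr; try exact: (rk_kernel rk).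
rewrite !(rk_reproducing rk); try exact: (rk_kernel rk).
have := Ka _ _ x0 xy; have := Ka _ _ xy x0; have := Ka _ _ xy xy.
have Kxy : K x y = K y x.
  by rewrite -(rk_reproducing rk y (rk_kernel rk x)) (rk_sym rk) ?(rk_reproducing rk)//; exact: (rk_kernel rk).
rewrite Kxy; set k0 := K x x; set k1 := K y x; set k2 := K y y; set q := _ / _ => c1 c2 c3.
move=> le1.
have k4 : (-1) ^+ 2 * k0 + 2 * -1 * k1 + k2 < 4 * q.
  by move: c1 c2 c3; rewrite !ltr_norml => /andP[? ?] /andP[? ?] /andP[? ?]; lra.
have f0 := rk_pos rk Hf.
rewrite -(ltr_pXn2r (n := 2)) ?nnegrE ?(ltW e0)// real_normK ?num_real//.
apply: le_lt_trans le1 _; apply: (@le_lt_trans _ _ (ip f f * (4 * q))).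
  by rewrite ler_wpM2l// ltW.
have -> : e ^+ 2 = (ip f f + 1) * (4 * q).
  by rewrite /q; field; rewrite gt_eqF// ltr_wpDl.
by rewrite ltr_pM2r ?ltrDl// mulr_gt0.
Qed.

Lemma rk_diag_bounded : exists2 M : R, 0 <= M & forall x, K x x <= M.
Proof.
have [M KM] : exists M : R, forall x, `|K x x| <= M.
  apply: (@tcont_bounded _ _ (fun x => K x x)).
    by move=> x k; have [-> _] := Kper x (Defs.shift x k) k; have [_ ->] := Kper x x k.
  apply: tdist_tcont => x e e0; have [a a0 Ka] := Kcont x x e0.
  by exists a => // y xy; exact: Ka.
exists M; first by apply: le_trans (KM [tuple 0 | i < d]).
by move=> x; exact: le_trans (ler_norm _) (KM x).
Qed.

Lemma rk_sup_bound : exists2 M : R, 0 <= M &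
  forall f x, H f -> `|f x| <= M * Num.sqrt (ip f f).
Proof.
have [M M0 KM] := rk_diag_bounded; exists (Num.sqrt M); first exact: sqrtr_ge0.
move=> f x Hf; have f0 := rk_pos rk Hf.
rewrite -sqrtr_sqr -sqrtrM//; apply: ler_wsqrtr.
by apply: le_trans (rk_eval_le x Hf) _; rewrite mulrC ler_wpM2r.
Qed.

Lemma rk_bmeas f : H f -> tmeasurable f -> bmeas (f : d.-tuple R -> R).
Proof.
move=> Hf mf; split => //; have [M _ fM] := rk_sup_bound.
by exists (M * Num.sqrt (ip f f)) => x; exact: fM.
Qed.

End ReproducingKernel.

(** * Fourier partial sums *)

Section RealEsum.
Context (R : realType) (T : choiceType) (a : T -> R).

Lemma sum_le_esum (F : seq T) : uniq F ->
  ((\sum_(k <- F) a k)%:E <= \esum_(k in [set: T]) (a k)%:E)%E.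
Proof.
move=> uF; apply: esum_ge; exists [set` F]; first by split.
by rewrite -sumEFin fsbig_seq.
Qed.

(** Stated for every [F] containing [F0], because [F] will be symmetrized and shared by two
    functions. *)
Lemma esum_tail (e : R) : (forall k, 0 <= a k) -> 0 < e -> (\esum_(k in [set: T]) (a k)%:E < +oo)%E ->
  exists F0 : seq T, forall F : seq T, {subset F0 <= F} ->
    (\esum_(k in [set: T]) (if k \in F then 0 else a k)%:E <= e%:E)%E.
Proof.
move=> a0 e0 fin.
have S0 : (0 <= \esum_(k in [set: T]) (a k)%:E)%E by apply: esum_ge0 => k _; rewrite lee_fin.
have Sfin : \esum_(k in [set: T]) (a k)%:E \is a fin_num by rewrite ge0_fin_numE.
have [_ [A [finA _] <-]] := ub_ereal_sup_adherent e0 Sfin.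
rewrite -/(esum _ _) => SA.
have /finite_seqP[F0 AF0] := finA; exists F0 => F F0F.
have split_a : (\esum_(k in [set: T]) (a k)%:E =
    \esum_(k in [set: T]) (if k \in F then a k else 0)%:E +
    \esum_(k in [set: T]) (if k \in F then 0 else a k)%:E)%E.
  rewrite -esumD.
  - by apply: eq_esum => k _; case: ifP; rewrite -EFinD ?addr0 ?add0r.
  - by move=> k _; case: ifP; rewrite lee_fin.
  - by move=> k _; case: ifP; rewrite lee_fin.
have leA : (\sum_(k \in A) (a k)%:E <= \esum_(k in [set: T]) (if k \in F then a k else 0)%:E)%E.
  apply: esum_ge; exists A => //.
  rewrite le_eqVlt (_ : (_ == _))//; apply/eqP; apply: eq_fsbigr => k.
  by rewrite inE AF0/= => /F0F ->.
have T0 : (0 <= \esum_(k in [set: T]) (if k \in F then 0 else a k)%:E)%E.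
  by apply: esum_ge0 => k _; case: ifP; rewrite lee_fin.
have I0 : (0 <= \esum_(k in [set: T]) (if k \in F then a k else 0)%:E)%E.
  by apply: esum_ge0 => k _; case: ifP; rewrite lee_fin.
move: SA leA T0 I0 Sfin; rewrite split_a.
set x := (\sum_(_ \in _) _)%E.
case: (esum _ _) => [u| |]; case: (esum _ _) => [v| |]; case: x => [w| |] //=.
by rewrite -!EFinD !lee_fin lte_fin => *; lra.
Qed.

End RealEsum.

Section FourierCas.
Context (R : realType) (d : nat).
Implicit Types (f g : d.-tuple R -> R) (k j : d.-tuple int).

Definition hcoef f k : R := rint (fun x => f x * cas k x).

Lemma hcoefB f g k : bmeas f -> bmeas g ->
  hcoef (fun x => f x - g x) k = hcoef f k - hcoef g k.
Proof.
move=> bf bg; rewrite /hcoef -(rintB (bmeasM bf (bmeas_cas R k)) (bmeasM bg (bmeas_cas R k))).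
by congr rint; apply/funext => x; rewrite mulrBl.
Qed.

Definition partial_sum (F : seq (d.-tuple int)) (c : d.-tuple int -> R) (x : d.-tuple R) : R :=
  \sum_(k <- F) c k * cas k x.

Lemma bmeas_partial_sum F c : bmeas (partial_sum F c).
Proof. by apply: bmeas_sum => k; apply: bmeasZ; exact: bmeas_cas. Qed.

Lemma partial_sum_periodic F c : tperiodic (partial_sum F c).
Proof. by move=> x k; apply: eq_bigr => j _; rewrite cas_periodic. Qed.

Lemma tcont_partial_sum F c : tcont (partial_sum F c).
Proof. by apply: tcont_sum => k; apply: tcontZ; exact: tcont_cas. Qed.

Lemma hcoef_partial_sum F c k : uniq F ->
  hcoef (partial_sum F c) k = if k \in F then c k else 0.
Proof.
move=> uF; rewrite /hcoef.
rewrite (_ : (fun x => _) = fun x => \sum_(j <- F) c j * (cas j x * cas k x)); last first.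
  by apply/funext => x; rewrite mulr_suml; apply: eq_bigr => j _; rewrite mulrA.
have bc j : bmeas (fun x : d.-tuple R => cas j x * cas k x).
  exact: (bmeasM (bmeas_cas R j) (bmeas_cas R k)).
rewrite rint_sum; last by move=> j; exact: bmeasZ.
under eq_bigr do rewrite rintZ// rint_casM.
case: ifPn => kF.
  rewrite (bigD1_seq k)//= eqxx mulr1 big1 ?addr0// => j /negPf ->.
  by rewrite mulr0.
rewrite big_seq big1// => j jF; case: eqP => [jk|]; last by rewrite mulr0.
by rewrite -jk jF in kF.
Qed.

(* In terms of [hcoef], since the cosine coefficients are the even part and
   the sine coefficients the odd part of [hcoef f]. *)
Lemma sob_sumE s f : bmeas f -> sob_sum s f =
  \esum_(k in [set: d.-tuple int])
    (sob_weight s k * ((hcoef f k ^+ 2 + hcoef f (topp k) ^+ 2) / 2))%:E.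
Proof.
move=> bf; apply: eq_esum => k _; congr (_ * _)%:E.
have bc : bmeas (fun x => f x * cos (arg k x)).
  by apply: bmeasM => //; apply: bmeas_cos; exact: measurable_arg.
have bs : bmeas (fun x => f x * sin (arg k x)).
  by apply: bmeasM => //; apply: bmeas_sin; exact: measurable_arg.
rewrite /fourier_re /fourier_im.
rewrite (tint_EFin bc) (tint_EFin bs)/=.
have -> : hcoef f k = rint (fun x => f x * cos (arg k x)) + rint (fun x => f x * sin (arg k x)).
  by rewrite -rintD//; congr rint; apply/funext => x; rewrite /cas mulrDr.
have -> : hcoef f (topp k) = rint (fun x => f x * cos (arg k x)) - rint (fun x => f x * sin (arg k x)).
  by rewrite -rintB//; congr rint; apply/funext => x; rewrite cas_topp mulrBr.
by field.
Qed.

Definition energy s f k : R :=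
  sob_weight s k * ((hcoef f k ^+ 2 + hcoef f (topp k) ^+ 2) / 2).

Lemma energy_ge0 s f k : 0 <= energy s f k.
Proof.
by rewrite mulr_ge0 ?divr_ge0 ?addr_ge0 ?sqr_ge0// ltW// sob_weight_gt0.
Qed.

(** The factor 2 pays for dropping the coefficient at [topp k] from the average in [energy]. *)
Lemma hcoef_sum_le s f F : bmeas f -> (sob_sum s f < +oo)%E -> uniq F ->
  \sum_(k <- F) sob_weight s k * hcoef f k ^+ 2 <= 2 * Hs_norm s f ^+ 2.
Proof.
move=> bf ff uF.
have sE : sob_sum s f = \esum_(k in [set: d.-tuple int]) (energy s f k)%:E by exact: sob_sumE.
have s0 : (0 <= sob_sum s f)%E by rewrite sE; apply: esum_ge0 => k _; rewrite lee_fin energy_ge0.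
have fin : sob_sum s f \is a fin_num by rewrite ge0_fin_numE.
rewrite /Hs_norm sqr_sqrtr ?fine_ge0//.
have := @sum_le_esum R _ (energy s f) F uF.
rewrite -sE -[leRHS](fineK fin) lee_fin => le1.
apply: le_trans (ler_wpM2l _ le1) => //; rewrite mulr_sumr; apply: ler_sum => k _.
have -> : 2 * energy s f k = sob_weight s k * (hcoef f k ^+ 2 + hcoef f (topp k) ^+ 2).
  by rewrite /energy; field.
by rewrite ler_wpM2l ?lerDl ?sqr_ge0// ltW// sob_weight_gt0.
Qed.

(** The energy at [k] also involves the coefficient at [topp k]; truncation to [F] keeps or kills
    each energy as a whole only if [F] is symmetric. *)
Definition symmetric_seq (F : seq (d.-tuple int)) := forall k, (topp k \in F) = (k \in F).

Lemma symmetric_undup F : symmetric_seq (undup (F ++ map (@topp d) F)).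
Proof.
have mem_topp k : (k \in map (@topp d) F) = (topp k \in F).
  by rewrite -{1}(toppK k) mem_map//; exact: can_inj (@toppK d).
by move=> k; rewrite !mem_undup !mem_cat !mem_topp toppK orbC.
Qed.

Lemma partial_sum_inHs s f F : bmeas f -> (sob_sum s f < +oo)%E -> uniq F ->
  symmetric_seq F -> inHs s (partial_sum F (hcoef f)).
Proof.
move=> bf ff uF sF; have bp := bmeas_partial_sum F (hcoef f).
split; [exact: partial_sum_periodic|by case: bp| |].
  have bpp : bmeas (fun x => partial_sum F (hcoef f) x ^+ 2) by exact: (bmeasM bp bp).
  by rewrite (tint_EFin bpp) ltry.
apply: le_lt_trans ff; rewrite !sob_sumE//; apply: le_esum => k _; rewrite lee_fin.
rewrite !hcoef_partial_sum// sF; case: ifP => // _.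
by rewrite expr0n addr0 mul0r mulr0; exact: (energy_ge0 s f k).
Qed.

Lemma Hs_norm_tail s f : bmeas f -> (sob_sum s f < +oo)%E -> forall e : R, 0 < e ->
  exists F0 : seq (d.-tuple int), forall F, uniq F -> symmetric_seq F -> {subset F0 <= F} ->
    Hs_norm s (fun x => f x - partial_sum F (hcoef f) x) <= e.
Proof.
move=> bf ff e e0; have e2 : 0 < e ^+ 2 by rewrite exprn_gt0.
have [|F0 tail] := @esum_tail R _ (energy s f) _ (energy_ge0 s f) e2; first by rewrite -[esum _ _]sob_sumE.
exists F0 => F uF sF F0F; rewrite /Hs_norm -(ger0_norm (ltW e0)) -sqrtr_sqr ler_wsqrtr//.
have bp := bmeas_partial_sum F (hcoef f); have bfp := bmeasB bf bp.
have -> : sob_sum s (fun x => f x - partial_sum F (hcoef f) x) =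
    \esum_(k in [set: d.-tuple int]) (if k \in F then 0 else energy s f k)%:E.
  rewrite (sob_sumE s bfp); apply: eq_esum => k _; congr EFin.
  rewrite !hcoefB// !hcoef_partial_sum// sF; case: ifP => _.
    by rewrite !subrr expr0n addr0 mul0r mulr0.
  by rewrite !subr0.
have := tail F F0F; case: (esum _ _) => [x| |]//=.
(* Only the value -oo remains, and [fine] sends it to 0. *)
by move=> _; rewrite sqr_ge0.
Qed.

End FourierCas.

(** * The quadrature error *)

Section Quadrature.
Context (R : realType) (d : nat).
Implicit Types f g : d.-tuple R -> R.

Definition qerr N f : R := rint f - uint (fun t => f (geod d N t)).

Lemma qerr_norm_le N f e : bmeas f -> (forall x, `|f x| <= e) -> `|qerr N f| <= 2 * e.
Proof.
move=> bf fe; rewrite mulr_natl mulr2n; apply: le_trans (ler_normB _ _) _; apply: lerD.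
  by apply: rint_norm_le => // x _; exact: fe.
by apply: uint_norm_le => [|t _]; [exact: bmeas_geod|exact: fe].
Qed.

Lemma qerrB N f g : bmeas f -> bmeas g ->
  qerr N (fun x => f x - g x) = qerr N f - qerr N g.
Proof.
move=> bf bg; rewrite /qerr rintB// uintB; try exact: bmeas_geod.
by ring.
Qed.

Lemma qerr_partial_sumM N (F : seq (d.-tuple int)) (h g : d.-tuple int -> R) :
  `|qerr N (fun x => partial_sum F h x * partial_sum F g x)| <=
  \sum_(k <- F) \sum_(j <- F | alias N k j) `|h k| * `|g j|.
Proof.
pose t (k j : d.-tuple int) (x : d.-tuple R) := h k * g j * (cas k x * cas j x).
have bt k j : bmeas (t k j).
  by apply: bmeasZ; exact: (bmeasM (bmeas_cas R k) (bmeas_cas R j)).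
have -> : (fun x => partial_sum F h x * partial_sum F g x) =
    fun x => \sum_(k <- F) \sum_(j <- F) t k j x.
  apply/funext => x; rewrite mulr_suml; apply: eq_bigr => k _.
  by rewrite mulr_sumr; apply: eq_bigr => j _; rewrite /t; ring.
have bt1 k : bmeas (fun x => \sum_(j <- F) t k j x) by exact: bmeas_sum.
have qt k j : qerr N (t k j) = if alias N k j then - (h k * g j) else 0.
  have bc : bmeas (fun x : d.-tuple R => cas k x * cas j x).
    exact: (bmeasM (bmeas_cas R k) (bmeas_cas R j)).
  rewrite /qerr /t rintZ// uintZ; last exact: (bmeas_geod N bc).
  rewrite uint_casM_geod rint_casM /alias tsub_eq0.
  have [<-|_] := eqVneq k j.
    have -> : freq N (tsub k k) = 0.
      by rewrite /freq big1// => i _; rewrite tnth_mktuple subrr mul0r.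
    by rewrite eqxx subrr.
  by rewrite andbT; case: eqP => _; rewrite ?mulr0 ?mulr1 ?subrr ?sub0r.
have -> : qerr N (fun x => \sum_(k <- F) \sum_(j <- F) t k j x) =
    \sum_(k <- F) \sum_(j <- F) qerr N (t k j).
  rewrite /qerr rint_sum// uint_sum; last by move=> k; exact: (bmeas_geod N (bt1 k)).
  rewrite -sumrB; apply: eq_bigr => k _; rewrite rint_sum// uint_sum; last first.
    by move=> j; exact: (bmeas_geod N (bt k j)).
  by rewrite -sumrB.
apply: le_trans (ler_norm_sum _ _ _) _; apply: ler_sum => k _.
apply: le_trans (ler_norm_sum _ _ _) _; rewrite [leRHS]big_mkcond/=.
apply: ler_sum => j _; rewrite qt; case: ifP => _; last by rewrite normr0.
by rewrite normrN normrM.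
Qed.

End Quadrature.

Section KernelQuadrature.
Context (R : realType) (d : nat) (s : R) (K : pt R d -> pt R d -> R)
  (H : set (pt R d -> R)) (ip : (pt R d -> R) -> (pt R d -> R) -> R).
Context (rk : is_RKHS K H ip) (Kper : kernel_periodic K) (Kcont : kernel_continuous K)
  (HKs : HK_eq_Hs s H ip).

Lemma rk_inHs f : H f -> inHs s f.
Proof. by case: HKs => + _ _; apply. Qed.

Lemma rk_bounded_measurable f : H f -> bmeas (f : d.-tuple R -> R).
Proof. by move=> Hf; apply: (rk_bmeas rk Kper Kcont) => //; case: (rk_inHs Hf). Qed.

Lemma inHs_tcont_in_rk f : inHs s f -> tcont f -> bmeas (f : d.-tuple R -> R) -> H f.
Proof.
move=> fHs cf bf; have [_ /(_ f fHs)[g Hg fg] _] := HKs.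
have [pf _ _ _] := fHs; rewrite (ae_eq_tcont pf (rk_per rk Hg) cf (rk_tcont rk Kcont Hg) bf _ fg)//.
exact: rk_bounded_measurable.
Qed.

Lemma rk_partial_sum f F : H f -> uniq F -> symmetric_seq F -> H (partial_sum F (hcoef f)).
Proof.
move=> Hf uF sF; apply: inHs_tcont_in_rk.
- by case: (rk_inHs Hf) => *; apply: partial_sum_inHs => //; exact: rk_bounded_measurable.
- exact: tcont_partial_sum.
- exact: bmeas_partial_sum.
Qed.

Lemma rk_approx f (e : R) : H f -> 0 < e ->
  exists F0 : seq (d.-tuple int), forall F, uniq F -> symmetric_seq F -> {subset F0 <= F} ->
    forall x, `|f x - partial_sum F (hcoef f) x| <= e.
Proof.
move=> Hf e0; have [M M0 supM] := rk_sup_bound rk Kper Kcont.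
have [_ _ [a [b [a0 b0 ab]]]] := HKs.
have Mb : 0 < M * b + 1 by rewrite ltr_wpDl// mulr_ge0// ltW.
have [_ _ _ ff] := rk_inHs Hf.
have [F0 tail] := Hs_norm_tail (rk_bounded_measurable Hf) ff (divr_gt0 e0 Mb).
exists F0 => F uF sF F0F x; have Hp := rk_partial_sum Hf uF sF.
have Hfp : H (fun x => f x - partial_sum F (hcoef f) x).
  have := rk_lin rk (-1) Hp Hf; congr H; apply/funext => y.
  by rewrite mulN1r addrC.
apply: le_trans (supM _ x Hfp) _; have [_ le2] := ab _ Hfp.
apply: le_trans (ler_wpM2l M0 le2) _; rewrite mulrA.
have Mb0 : 0 <= M * b by rewrite mulr_ge0// ltW.
apply: le_trans (ler_wpM2l Mb0 (tail F uF sF F0F)) _.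
by rewrite mulrA ler_pdivrMr// mulrC ler_wpM2l ?(ltW e0)// lerDl.
Qed.

Lemma rk_qerr_alias N (f g : pt R d -> R) (B : R) : H f -> H g ->
  (forall F : seq (d.-tuple int), uniq F ->
    \sum_(k <- F) \sum_(j <- F | alias N k j) `|hcoef f k| * `|hcoef g j| <= B) ->
  `|qerr N (fun x => f x * g x)| <= B.
Proof.
move=> Hf Hg leB; have bf := rk_bounded_measurable Hf; have bg := rk_bounded_measurable Hg.
have [_ [Mf fM]] := bf; have [_ [Mg gM]] := bg.
have Mf0 : 0 <= Mf by apply: le_trans (fM [tuple 0 | i < d]).
have Mg0 : 0 <= Mg by apply: le_trans (gM [tuple 0 | i < d]).
(* If both factors are approximated within u <= 1, the product is approximated within (Mf + Mg + 1)
   u, the quadratic term being at most u; [qerr_norm_le] doubles this, hence [D]. *)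
apply/ler_addgt0Pr => e e0; pose D := 2 * (Mf + Mg + 1).
have D0 : 0 < D by rewrite mulr_gt0// ltr_wpDl// addr_ge0.
pose u := Num.min 1 (e / D); have u0 : 0 < u by rewrite lt_min ltr01 divr_gt0.
have u1 : u <= 1 by rewrite ge_min lexx.
have uD : u * D <= e by rewrite -ler_pdivlMr// ge_min lexx orbT.
have [F1 approx1] := rk_approx Hf u0; have [F2 approx2] := rk_approx Hg u0.
pose F := undup ((F1 ++ F2) ++ map (@topp d) (F1 ++ F2)).
have uF : uniq F by exact: undup_uniq.
have sF : symmetric_seq F by exact: symmetric_undup.
have sub1 : {subset F1 <= F} by move=> k kF; rewrite mem_undup !mem_cat kF.
have sub2 : {subset F2 <= F} by move=> k kF; rewrite mem_undup !mem_cat kF orbT.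
have af := approx1 F uF sF sub1; have ag := approx2 F uF sF sub2.
pose p := partial_sum F (hcoef f); pose q := partial_sum F (hcoef g).
have bfg : bmeas (fun x : d.-tuple R => f x * g x) by exact: (bmeasM bf bg).
have bpq : bmeas (fun x => p x * q x).
  exact: (bmeasM (bmeas_partial_sum F (hcoef f)) (bmeas_partial_sum F (hcoef g))).
have close x : `|f x * g x - p x * q x| <= (Mf + Mg + 1) * u.
  have -> : f x * g x - p x * q x = (f x - p x) * g x + f x * (g x - q x)
    - (f x - p x) * (g x - q x) by ring.
  have f1 : `|(f x - p x) * g x| <= u * Mg by rewrite normrM ler_pM.
  have f2 : `|f x * (g x - q x)| <= Mf * u by rewrite normrM ler_pM.
  have f3 : `|(f x - p x) * (g x - q x)| <= 1 * u.
    by rewrite normrM ler_pM//; apply: le_trans (af x) u1.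
  apply: le_trans (ler_normB _ _) _.
  have := ler_normD ((f x - p x) * g x) (f x * (g x - q x)); lra.
have -> : qerr N (fun x => f x * g x) =
    qerr N (fun x => p x * q x) + qerr N (fun x => f x * g x - p x * q x).
  by rewrite qerrB//; ring.
apply: le_trans (ler_normD _ _) _; apply: lerD.
  exact: le_trans (qerr_partial_sumM _ _ _ _) (leB F uF).
apply: le_trans (qerr_norm_le N (bmeasB bfg bpq) close) _.
by rewrite mulrA mulrC.
Qed.

Lemma inHs_cst1 : inHs s (fun _ : pt R d => 1 : R).
Proof.
pose one : d.-tuple R -> R := fun=> 1.
have oneE : one = partial_sum [:: tzero d] (fun=> 1).
  by apply/funext => x; rewrite /partial_sum big_seq1 cas0 mulr1.
have b1 : bmeas one by rewrite oneE; exact: bmeas_partial_sum.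
have b11 : bmeas (fun x => one x ^+ 2) by exact: (bmeasM b1 b1).
split => //; first by case: b1.
  by rewrite (tint_EFin b11) ltry.
have t0 : topp (tzero d) = tzero d by apply: eq_from_tnth => i; rewrite !tnth_mktuple oppr0.
rewrite -/one (sob_sumE s b1) (@eq_esum _ _ _ _ (fun k =>
  if k \in [set tzero d] then (sob_weight s k)%:E else 0%E)); last first.
  move=> k _; rewrite oneE !hcoef_partial_sum// !inE.
  have -> : (topp k == tzero d) = (k == tzero d) by rewrite -{1}t0 (can_eq (@toppK d)).
  have -> : (k \in [set tzero d]) = (k == tzero d) by apply/idP/eqP; rewrite inE.
  case: eqP => _; last by rewrite expr0n addr0 mul0r mulr0.
  by rewrite expr1n -mulr2n divff// mulr1.
rewrite -esum_mkcond esum_set1 ?ltry// lee_fin; exact/ltW/sob_weight_gt0.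
Qed.

Lemma rk_cst1 : H (fun=> 1).
Proof.
apply: inHs_tcont_in_rk; [exact: inHs_cst1|exact: tcont_cst|exact: bmeas_cst].
Qed.

End KernelQuadrature.

(** * Choice of the curve parameter and the final estimate *)

Section Assembly.
Context (R : realType).

Lemma rk_qerr_bound n (s : R) (K : pt R n.+2 -> pt R n.+2 -> R)
    (H : set (pt R n.+2 -> R)) (ip : (pt R n.+2 -> R) -> (pt R n.+2 -> R) -> R) :
  n.+2%:R / 2 < s -> is_RKHS K H ip -> kernel_periodic K -> kernel_continuous K ->
  HK_eq_Hs s H ip -> forall A : R, 0 <= A ->
  exists2 C : R, 0 <= C & forall N f g, (2 <= N)%N -> H f -> H g ->
    ip f f <= A -> ip g g <= A ->
    `|qerr N (fun x => f x * g x)| <= C * N%:R `^ (- s).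
Proof.
move=> ds rk Kper Kcont HKs A A0; have [_ _ [a [b [a0 b0 ab]]]] := HKs.
(* The lower norm equivalence bounds the squared Sobolev norm by A / a^2; the 2 is that of
   [hcoef_sum_le]. *)
pose A' := 2 * (A / a ^+ 2).
have A'0 : 0 <= A' by rewrite mulr_ge0// divr_ge0// sqr_ge0.
have [C C0 aliasC] := alias_sum_bound ds A'0; exists C => // N f g N2 Hf Hg fA gA.
have coefA h F : H h -> ip h h <= A -> uniq F ->
    \sum_(k <- F) sob_weight s k * hcoef h k ^+ 2 <= A'.
  move=> Hh hA uF; have [_ _ _ hfin] := rk_inHs HKs Hh.
  apply: le_trans (hcoef_sum_le (rk_bounded_measurable rk Kper Kcont HKs Hh) hfin uF) _.
  rewrite ler_wpM2l// ler_pdivlMr ?exprn_gt0// mulrC -exprMn.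
  have [le1 _] := ab _ Hh.
  have : (a * Hs_norm s h) ^+ 2 <= ipnorm ip h ^+ 2.
    by rewrite ler_sqr ?nnegrE ?sqrtr_ge0// mulr_ge0 ?sqrtr_ge0// ltW.
  by rewrite /ipnorm sqr_sqrtr ?(rk_pos rk Hh)// => /le_trans; apply.
apply: (rk_qerr_alias rk Kper Kcont HKs Hf Hg) => F uF.
by apply: aliasC => //; exact: coefA.
Qed.

Lemma geod_closed d N : tdist (geod d N 0) (geod d N 1) = 0 :> R.
Proof.
have -> : geod d N 1 = Defs.shift (geod d N 0) [tuple N%:Z ^+ i | i < d] :> pt R d.
  apply: eq_from_tnth => i; rewrite !tnth_mktuple mul1r mul0r add0r.
  by rewrite rmorphXn/= -pmulrn.
exact: tdist_shift.
Qed.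

Lemma geod_lipschitz n N (t t' : R) : (1 <= N)%N ->
  tdist (geod n.+2 N t) (geod n.+2 N t') <= n.+2%:R * N%:R ^+ n.+1 * `|t - t'|.
Proof.
move=> N1; apply: le_trans (tdist_le _ _) _.
apply: (@le_trans _ _ (\sum_(i < n.+2) N%:R ^+ n.+1 * `|t - t'|)).
  apply: ler_sum => i _; rewrite !tnth_mktuple -mulrBl normrM mulrC ler_wpM2r//.
  rewrite ger0_norm ?exprn_ge0//; apply: ler_weXn2l; first by rewrite ler1n.
  by rewrite -ltnS.
by rewrite sumr_const card_ord -mulrA mulr_natl.
Qed.

(** N is the integer part of x = (L / D)^(1/m). For N > 0, x <= 2 N, so rounding costs a factor 2^s.
    The last conclusion serves small L: N < N0 forces L <= D N0^m, which bounds the target rate from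
    below. *)
Lemma geod_parameter_exists (m : nat) (D s : R) : (0 < m)%N -> 0 < D -> 0 <= s ->
  forall L : R, 0 < L -> exists N : nat,
    [/\ (0 < N)%N -> D * N%:R ^+ m <= L,
        (0 < N)%N -> N%:R `^ (- s) <= (2 `^ s * D `^ (s / m%:R)) * L `^ (- (s / m%:R))
      & forall N0 : nat, (N < N0)%N ->
          1 <= (D * N0%:R ^+ m) `^ (s / m%:R) * L `^ (- (s / m%:R))].
Proof.
move=> m0 D0 s0 L L0; have m0' : m%:R != 0 :> R by rewrite pnatr_eq0 -lt0n.
have LD0 : 0 < L / D by rewrite divr_gt0.
pose x := (L / D) `^ (m%:R^-1); have x0 : 0 < x by exact: powR_gt0.
have xm : x ^+ m = L / D by rewrite -powR_mulrn ?ltW// -powRrM mulVf// powRr1// ltW.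
have xs : x `^ s = L `^ (s / m%:R) / D `^ (s / m%:R).
  have Dinv p : D^-1 `^ p = (D `^ p)^-1.
    by rewrite -(powR_inv1 (ltW D0)) -powRrM mulN1r powRN.
  by rewrite /x -powRrM [_^-1 * s]mulrC powRM ?invr_ge0 ?(ltW L0) ?(ltW D0)// Dinv.
have sm0 : 0 <= s / m%:R by rewrite divr_ge0.
have /andP[xN Nx] := truncn_itv (ltW x0); exists (Num.trunc x); split.
- move=> N0; rewrite mulrC -ler_pdivlMr// -xm; by apply: lerXn2r => //; rewrite nnegrE ?(ltW x0) ?ler0n.
- move=> N0; have N2x : x <= 2 * (Num.trunc x)%:R.
    apply: le_trans (ltW Nx) _; rewrite -natrM ler_nat mul2n -addnn -addn1 leq_add2l//.
  have N0' : 0 < (Num.trunc x)%:R :> R by rewrite ltr0n.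
  have : x `^ s <= 2 `^ s * (Num.trunc x)%:R `^ s.
    by rewrite -powRM ?(ltW N0')//; apply: ge0_ler_powR; rewrite ?nnegrE ?(ltW x0).
  rewrite xs ler_pdivrMr ?powR_gt0// => le1.
  rewrite !powRN ler_pdivlMr ?powR_gt0// mulrC ler_pdivrMr ?powR_gt0//.
  by apply: le_trans le1 _; rewrite mulrAC.
- move=> N0 NN0; rewrite powRN ler_pdivlMr ?powR_gt0// mul1r.
  apply: ge0_ler_powR; rewrite ?nnegrE ?mulr_ge0 ?exprn_ge0 ?(ltW L0) ?(ltW D0)//.
  rewrite mulrC -ler_pdivrMr// -xm; apply: lerXn2r; rewrite ?nnegrE ?(ltW x0)//.
  by apply: le_trans (ltW Nx) _; rewrite ler_nat.
Qed.

Lemma eventually_small (C s : R) : 0 <= C -> 0 < s ->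
  exists N0 : nat, forall N, (N0 <= N)%N -> C * N%:R `^ (- s) <= 1 / 2.
Proof.
move=> C0 s0; pose y := (2 * C + 1) `^ s^-1.
have c0 : 0 < 2 * C + 1 by rewrite ltr_wpDl// mulr_ge0.
have y0 : 0 < y by exact: powR_gt0.
exists (Num.trunc y).+1 => N yN.
have yN' : y <= N%:R.
  by apply: le_trans (_ : (Num.trunc y).+1%:R <= _); [exact/ltW/truncnS_gt|rewrite ler_nat].
have N0 : 0 < N%:R :> R by exact: lt_le_trans yN'.
have : 2 * C + 1 <= N%:R `^ s.
  have -> : 2 * C + 1 = y `^ s by rewrite -powRrM mulVf ?gt_eqF// powRr1// ltW.
  by apply: ge0_ler_powR; rewrite ?nnegrE ?(ltW s0) ?(ltW y0) ?(ltW N0).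
rewrite powRN ler_pdivrMr ?powR_gt0//; lra.
Qed.

End Assembly.

Theorem theorem6 (R : realType) (d : nat) (s : R)
  (K : pt R d -> pt R d -> R) (H : set (pt R d -> R))
  (ip : (pt R d -> R) -> (pt R d -> R) -> R) :
  (2 <= d)%N -> d%:R / 2 < s ->
  kernel_periodic K -> kernel_continuous K -> kernel_symmetric K ->
  kernel_posdef K ->
  is_RKHS K H ip -> HK_eq_Hs s H ip ->
  forall rho : pt R d -> R,
    tperiodic rho -> tmeasurable rho -> (forall x, 0 <= rho x) ->
    tint (fun x => (rho x)%:E) = 1%E ->
    torus_lipschitz rho -> inHs s rho ->
  exists2 c : R, 0 < c &
    forall L : R, 1 <= L ->
      exists gamma : R -> pt R d, exists rho' : R -> R,
        acurve_data L gamma rho' /\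
        (discrepancy H ip rho gamma rho' <= (c * L `^ (- (s / (d.-1)%:R)))%:E)%E.
Proof.
move=> d2 ds Kper Kcont _ _ rk HKs rho rper rmeas r0 r1 [Cl0 rlip] rHs.
case: d d2 => [//|[//|n]] _ in K H ip ds Kper Kcont rk HKs rho rper rmeas r0 r1 rlip rHs *.
rewrite [n.+2.-1]/=; set m := n.+1; set Cl := `|Cl0|.
have {}rlip x y : `|rho x - rho y| <= Cl * tdist x y.
  by apply: le_trans (rlip x y) _; rewrite ler_wpM2r ?tdist_ge0 ?ler_norm.
have Cl_ge0 : 0 <= Cl by exact: normr_ge0.
have s0 : 0 < s by apply: le_lt_trans ds; rewrite divr_ge0.
have rcont : tcont rho.
  apply: tdist_tcont => x e e0; exists (e / (Cl + 1)).
    by rewrite divr_gt0// ltr_wpDl.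
  move=> y; rewrite ltr_pdivlMr ?ltr_wpDl// => xy; rewrite distrC.
  apply: le_lt_trans (rlip x y) _; apply: le_lt_trans xy.
  by rewrite mulrC ler_wpM2l ?tdist_ge0// lerDl.
have brho : bmeas (rho : n.+2.-tuple R -> R).
  by split => //; exact: tcont_bounded.
have Hrho : H rho by exact: (inHs_tcont_in_rk rk Kper Kcont HKs).
have Hone : H (fun=> 1) by exact: (rk_cst1 rk Kper Kcont HKs).
have rint_rho : rint rho = 1 by move: r1; rewrite tint_EFin// => -[].
have [M M0 supM] := rk_sup_bound rk Kper Kcont.
have supM1 phi x : H phi -> ip phi phi <= 1 -> `|phi x| <= M.
  move=> Hphi phi1; apply: le_trans (supM phi x Hphi) _.
  by rewrite ler_piMr// -sqrtr1 ler_wsqrtr.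
(* One bound for the squared norms of all functions fed to the quadrature estimate: phi, rho and
   1. *)
pose A := 1 + ip rho rho + ip (fun=> 1) (fun=> 1).
have rr0 := rk_pos rk Hrho; have oo0 := rk_pos rk Hone.
have A0 : 0 <= A by rewrite !addr_ge0.
have [C C0 qC] := rk_qerr_bound ds rk Kper Kcont HKs A0.
have [N1 smallN] := eventually_small C0 s0.
(* The 2 is for the lattice bound and [N1] makes Z at least 1/2. In [D], n.+2 comes from the
   Lipschitz constant of the geodesic, and 1 + 2 Cl covers both the curve and the weight, whose
   factor 1 / Z is at most 2. *)
pose N0 := maxn 2 N1; pose D : R := n.+2%:R * (1 + 2 * Cl).
have D0 : 0 < D by rewrite mulr_gt0// ltr_wpDr// mulr_ge0.
pose c1 := C * (1 + M) * (2 `^ s * D `^ (s / m%:R)).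
pose c2 := 2 * M * (D * N0%:R ^+ m) `^ (s / m%:R).
have c1_ge0 : 0 <= c1 by rewrite !mulr_ge0 ?addr_ge0 ?powR_ge0.
have c2_ge0 : 0 <= c2 by rewrite !mulr_ge0 ?powR_ge0.
exists (1 + c1 + c2); first by rewrite -addrA ltr_wpDr// addr_ge0.
move=> L L1; have L0 : 0 < L by exact: lt_le_trans L1.
have Lp0 : 0 <= L `^ (- (s / m%:R)) by exact: powR_ge0.
have [N [DN NL smallL]] := geod_parameter_exists (ltn0Sn n : (0 < m)%N) D0 (ltW s0) L0.
have bphi phi : H phi -> bmeas (phi : n.+2.-tuple R -> R).
  exact: (rk_bounded_measurable rk Kper Kcont HKs).
have [NN0|N0N] := ltnP N N0.
  (* A point mass at the origin: its discrepancy is at most 2 M, and [c2] is chosen so that this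
     suffices for such L. *)
  exists (fun=> [tuple 0 | i < n.+2]), (fun=> 1); split.
    split=> [|t t' _ _|//|t t' _ _|].
    - apply: le_anti; rewrite tdist_ge0 andbT; apply: le_trans (tdist_le _ _) _.
      by rewrite big1// => i _; rewrite subrr normr0.
    - apply: le_trans (tdist_le _ _) _; rewrite big1; last by move=> i _; rewrite subrr normr0.
      by rewrite mulr_ge0// ltW.
    - by rewrite subrr normr0 mulr_ge0// ltW.
    - by rewrite (uint_EFin (bmeas_cst _ 1)) uint_cst.
  apply: ge_ereal_sup => _ [phi [Hphi phi1] <-].
  have bpr : bmeas (fun x : n.+2.-tuple R => phi x * rho x) by exact: (bmeasM (bphi _ Hphi) brho).
  rewrite (tint_EFin bpr) (uint_EFin (bmeas_cst _ _)) uint_cst mulr1 -EFinB lee_fin.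
  have i1 : `|rint (fun x : n.+2.-tuple R => phi x * rho x)| <= M.
    have eM c : c = rint (fun x : n.+2.-tuple R => c * rho x) by rewrite rintZ// rint_rho mulr1.
    rewrite ler_norml; apply/andP; split; [rewrite [leLHS]eM|rewrite [leRHS]eM];
      apply: le_rint => //; (try exact: bmeasZ) => x _; apply: ler_wpM2r => //;
      by have := supM1 phi x Hphi phi1; rewrite ler_norml => /andP[].
  have i2 := supM1 phi [tuple 0 | i < n.+2] Hphi phi1.
  apply: (@le_trans _ _ (2 * M)); first by apply: le_trans (ler_normB _ _) _; lra.
  apply: (@le_trans _ _ (c2 * L `^ (- (s / m%:R)))).
    by rewrite /c2 -mulrA ler_peMr ?smallL// mulr_ge0.
  by rewrite ler_wpM2r// lerDr addr_ge0.
have N2 : (2 <= N)%N by rewrite (leq_trans _ N0N)// leq_maxl.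
have Npos : (0 < N)%N by exact: ltnW.
have qsmall := smallN N (leq_trans (leq_maxr _ _) N0N).
have {}DN := DN Npos; have {}NL := NL Npos.
pose g : R -> pt R n.+2 := geod n.+2 N; pose Z := uint (fun t => rho (g t)).
(* The mass defect of the unnormalized weight is the quadrature error of rho * 1. *)
have Z1 : `|1 - Z| <= C * N%:R `^ (- s).
  have := qC N rho (fun=> 1) N2 Hrho Hone; rewrite /qerr.
  have -> : (fun x => rho x * 1) = rho by apply/funext => x; rewrite mulr1.
  have -> : (fun t => rho (geod n.+2 N t) * 1) = fun t => rho (g t).
    by apply/funext => x; rewrite mulr1.
  by rewrite rint_rho; apply; rewrite /A; lra.
have Z2 : 1 / 2 <= Z by have := le_trans Z1 qsmall; rewrite ler_norml => /andP[? ?]; lra.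
have Z0 : 0 < Z by apply: lt_le_trans Z2.
have brg : bmeas (fun t : R => rho (g t)) by exact: (bmeas_geod N brho).
have gL t t' : (1 + 2 * Cl) * tdist (g t) (g t') <= L * `|t - t'|.
  rewrite -(@ler_pM2l _ n.+2%:R)// mulrA -/D.
  apply: le_trans (ler_wpM2l (ltW D0) (@geod_lipschitz _ n N t t' Npos)) _.
  rewrite -mulrA mulrCA ler_wpM2l// mulrA ler_wpM2r//.
exists g, (fun t => Z^-1 * rho (g t)); split.
  split=> [|t t' _ _|t _|t t' _ _|].
  - exact: geod_closed.
  - have := gL t t'; have := tdist_ge0 (g t) (g t'); nra.
  - by rewrite mulr_ge0// invr_ge0 ltW.
  - rewrite -mulrBr normrM gtr0_norm ?invr_gt0//.
    have Zi : Z^-1 <= 2 by rewrite -[leRHS]invrK lef_pV2 ?posrE// -div1r.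
    apply: le_trans (ler_pM _ _ Zi (rlip (g t) (g t'))) _; rewrite ?invr_ge0 ?(ltW Z0)//.
    have := gL t t'; have := tdist_ge0 (g t) (g t'); nra.
  - by rewrite (uint_EFin (bmeasZ _ brg)) uintZ// mulVf// gt_eqF.
apply: ge_ereal_sup => _ [phi [Hphi phi1] <-].
have bpr : bmeas (fun x : n.+2.-tuple R => phi x * rho x) by exact: (bmeasM (bphi _ Hphi) brho).
have bpg : bmeas (fun t : R => phi (g t) * rho (g t)) by exact: (bmeas_geod N bpr).
rewrite (tint_EFin bpr).
have -> : (fun t => (phi (g t) * (Z^-1 * rho (g t)))%:E) =
    fun t => (Z^-1 * (phi (g t) * rho (g t)))%:E.
  by apply/funext => t; rewrite mulrCA.
rewrite (uint_EFin (bmeasZ _ bpg)) uintZ// -EFinB lee_fin.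
set I := rint _; set J := uint _; set nu := N%:R `^ (- s) in Z1 qsmall NL *.
have IJ : `|I - J| <= C * nu by apply: qC => //; rewrite /A; lra.
have JM : `|Z^-1 * J| <= M.
  rewrite normrM gtr0_norm ?invr_gt0// mulrC ler_pdivrMr//.
  rewrite ler_norml; apply/andP; split;
    [rewrite -mulNr -uintZ//|rewrite -uintZ//]; apply: le_uint => //;
    (try exact: bmeasZ) => t _; apply: ler_wpM2r => //;
    by have := supM1 phi (g t) Hphi phi1; rewrite ler_norml => /andP[].
(* The first term is the quadrature error of phi * rho; the second is the cost of normalization, the
   mass defect times an average of phi, which [JM] bounds by M. *)
have -> : I - Z^-1 * J = (I - J) - Z^-1 * J * (1 - Z) by field; rewrite gt_eqF.
have JZ : `|Z^-1 * J * (1 - Z)| <= M * (C * nu) by rewrite normrM ler_pM.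
apply: (@le_trans _ _ (C * (1 + M) * nu)).
  by apply: le_trans (ler_normB _ _) _; move: IJ JZ; lra.
apply: (@le_trans _ _ (c1 * L `^ (- (s / m%:R)))).
  by rewrite /c1 -[leRHS]mulrA ler_wpM2l// mulr_ge0// addr_ge0.
by rewrite ler_wpM2r//; lra.
Qed.
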